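(* Let $\vec\alpha=(\alpha_1,\alpha_2)$ with $\alpha_1,\alpha_2>-1$, and let $1<p\le q<\infty$. Let $\mu$ be a positive measure on $\Pi^+\times\Pi^+$. The following assertions are equivalent. (a) $\mu$ is a $(\frac qp,\vec\alpha)$-Carleson measure, i.e. there is a constant $C>0$ such that for every rectangle $R=I_1\times I_2\in\mathcal R$, $$\mu(Q_R)\le C\big(\mathcal V_{\vec\alpha}(Q_R)\big)^{\frac qp}.$$ (b) There exists a constant $C>0$ such that for every $f\in A^p_{\vec\alpha}(\Pi^+\times\Pi^+)$, $$\int_{\Pi^+\times\Pi^+}|f(z)|^q\,d\mu(z)\le C\Big(\int_{\Pi^+\times\Pi^+}|f(z)|^p\,d\mathcal V_{\vec\alpha}(z)\Big)^{\frac qp}.$$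
   Context: $\Pi^+$ is the upper half-plane of $\mathbb C$. For an interval $I\subset\mathbb R$ with length $|I|$, the Carleson square is $Q_I=\{x+iy\in\Pi^+: x\in I,\ 0<y<|I|\}$. $\mathcal R$ is the set of all rectangles $R=I_1\times I_2$ in $\mathbb R^2$ with $I_1,I_2$ intervals, and $Q_R=Q_{I_1}\times Q_{I_2}$. For $\alpha>-1$, $dV_\alpha(x+iy)=y^\alpha dx\,dy$ on $\Pi^+$, and $d\mathcal V_{\vec\alpha}(z_1,z_2)=dV_{\alpha_1}(z_1)dV_{\alpha_2}(z_2)$ on $\Pi^+\times\Pi^+$, so $\mathcal V_{\vec\alpha}(Q_R)=V_{\alpha_1}(Q_{I_1})V_{\alpha_2}(Q_{I_2})$. The weighted Bergman space $A^p_{\vec\alpha}(\Pi^+\times\Pi^+)$ is the space of holomorphic functions $f$ on $\Pi^+\times\Pi^+$ with $\int_{\Pi^+\times\Pi^+}|f|^pd\mathcal V_{\vec\alpha}<\infty$. *)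

(* Defs.v *)
From HB Require Import structures.
From mathcomp Require Import all_boot all_order all_algebra.
From mathcomp Require Import complex.
From mathcomp Require Import all_classical all_reals all_analysis.
From mathcomp Require Import measurable_realfun.
Set Implicit Arguments.
Unset Strict Implicit.
Unset Printing Implicit Defensive.
Import Order.TTheory GRing.Theory Num.Theory.
Import numFieldNormedType.Exports.
Local Open Scope classical_set_scope.
Local Open Scope ring_scope.

(* There is no measurable structure on R[i]. For measures and integrals a
   complex number x + i y is therefore represented by the pair (x, y), so that
   the Borel sigma-algebra of C (resp. C^2) is the product sigma-algebra, and
   [to_complex], [to_complex2] recover the complex numbers at which holomorphic
   functions are evaluated. *)
Notation plane R := (measurableTypeR R * measurableTypeR R)%type.

Definition to_complex (R : realType) (z : plane R) : R[i]^o := (z.1 +i* z.2)%C.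

Definition to_complex2 (R : realType) (z : plane R * plane R) :
    R[i]^o * R[i]^o :=
  (to_complex z.1, to_complex z.2).

Definition upper (R : realType) : set (plane R) := [set z | 0 < z.2].
Arguments upper : clear implicits.

Definition bi_upper (R : realType) : set (plane R * plane R) :=
  upper R `*` upper R.
Arguments bi_upper : clear implicits.

Definition lebesgue2 (R : realType) : set (plane R) -> \bar R :=
  (@lebesgue_measure R \x @lebesgue_measure R)%E.
Arguments lebesgue2 : clear implicits.

HB.instance Definition _ (R : realType) := Measure.on (lebesgue2 R).

(* In the library, the sigma-finiteness instance of [\x] is shadowed by its
   instance for subprobabilities, hence this direct proof. *)
Lemma sigma_finite_lebesgue2 (R : realType) : sigma_finite setT (lebesgue2 R).
Proof.
have /sigma_finiteP[F [TF ndF Foo]] := sigma_finiteT (@lebesgue_measure R).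
exists (fun n => F n `*` F n).
  rewrite -setXTT TF predeqE => -[x y]; split.
    move=> [/= [n _ Fnx] [k _ Fky]]; exists (maxn n k) => //; split.
    - by move: x Fnx; exact/subsetPset/ndF/leq_maxl.
    - by move: y Fky; exact/subsetPset/ndF/leq_maxr.
  by move=> [n _ []/= ? ?]; split; exists n.
move=> k; have [? ?] := Foo k.
split; first exact: measurableX.
by rewrite /lebesgue2 product_measure1E// lte_mul_pinfty// ge0_fin_numE.
Qed.

HB.instance Definition _ (R : realType) :=
  Measure_isSigmaFinite.Build _ _ _ (lebesgue2 R) (@sigma_finite_lebesgue2 R).

(* The measure y^a dx dy on the upper half-plane, as a measure on the plane
   that vanishes outside [upper R]. *)
Definition Valpha (R : realType) (a : R) : set (plane R) -> \bar R :=
  fun A => (\int[lebesgue2 R]_(z in A `&` upper R)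
              (z.2 `^ a)%:E)%E.

Section Valpha.
Local Open Scope ereal_scope.
Context (R : realType) (a : R).

Lemma measurable_upper : measurable (upper R).
Proof.
rewrite (_ : upper R = setT `*` `]0%R, +oo[%classic).
  exact: measurableX.
by apply/seteqP; split => -[x y]; rewrite /upper/= in_itv/= andbT// => -[].
Qed.

Lemma measurable_density (D : set (plane R)) :
  measurable_fun D (fun z => z.2 `^ a)%R.
Proof.
apply: measurable_funTS.
exact: (measurableT_comp (measurable_powR a) measurable_snd).
Qed.

Let V0 : Valpha a set0 = 0.
Proof. by rewrite /Valpha set0I integral_set0. Qed.

Let V_ge0 A : 0 <= Valpha a A.
Proof. by apply: integral_ge0 => z _; rewrite lee_fin powR_ge0. Qed.

Let V_sigma_additive : semi_sigma_additive (Valpha a).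
Proof.
move=> F mF tF mUF.
rewrite [X in _ --> X](_ : _ = \sum_(n <oo) Valpha a (F n)).
  by apply/cvg_closeP; split; [exact: is_cvg_nneseries|rewrite closeE].
rewrite /Valpha setI_bigcupl ge0_integral_bigcup//.
- by move=> k; apply: measurableI => //; exact: measurable_upper.
- by apply/measurable_EFinP; exact: measurable_density.
- by move=> z _; rewrite lee_fin powR_ge0.
- exact: trivIset_setIr.
Qed.

HB.instance Definition _ :=
  isMeasure.Build _ _ _ (Valpha a) V0 V_ge0 V_sigma_additive.

Let V_sigma_finite : sigma_finite [set: plane R] (Valpha a).
Proof.
have /sigma_finiteP[E [TE ndE mE]] := sigma_finiteT (lebesgue2 R).
pose S n := [set z : plane R | (z.2 `^ a)%R%:E <= n%:R%:E].
have mS n : measurable (S n).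
  rewrite -[S n]setTI; apply: emeasurable_fun_le => //.
  by apply/measurable_EFinP; exact: measurable_density.
exists (fun n => E n `&` S n).
- apply/seteqP; split; last by [].
  move=> z _.
  have [k _ Ekz] : (\bigcup_i E i) z by rewrite -TE.
  exists (maxn k (Num.bound (z.2 `^ a)%R)) => //; split.
    by have /subsetPset := ndE _ _ (leq_maxl k (Num.bound (z.2 `^ a)%R)); apply.
  rewrite /S/= lee_fin.
  apply: (le_trans (ltW (archi_boundP (powR_ge0 z.2 a)))).
  by rewrite ler_nat leq_maxr.
- move=> n; split; first exact: measurableI (mE n).1 (mS n).
  have mESU : measurable (E n `&` S n `&` upper R).
    by apply: measurableI; [exact: measurableI (mE n).1 (mS n)|
                            exact: measurable_upper].
  apply: (@le_lt_trans _ _ (\int[lebesgue2 R]_(z in E n `&` S n `&` upper R)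
                              (cst n%:R%:E z))).
    apply: ge0_le_integral => //.
    + by move=> z _; rewrite lee_fin powR_ge0.
    + by apply/measurable_EFinP; exact: measurable_density.
    + by move=> z [[_ Sz] _].
  rewrite integral_cst//; apply: lte_mul_pinfty => //.
  apply: le_lt_trans (mE n).2; apply: le_measure; rewrite ?inE//.
    exact: (mE n).1.
  by move=> z [[]].
Qed.

HB.instance Definition _ :=
  Measure_isSigmaFinite.Build _ _ _ (Valpha a) V_sigma_finite.

End Valpha.

Definition Vbi (R : realType) (a1 a2 : R) : set (plane R * plane R) -> \bar R :=
  (Valpha a1 \x Valpha a2)%E.

HB.instance Definition _ (R : realType) (a1 a2 : R) :=
  Measure.on (Vbi a1 a2).

(* The length |I| is taken in the extended reals, so I may be any interval:
   open, closed, half-open, degenerate or unbounded. *)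
Definition carleson_square (R : realType) (I : interval R) : set (plane R) :=
  [set z | [/\ z.1 \in I, 0 < z.2 &
              (z.2%:E < lebesgue_measure [set` I])%E]].

Definition carleson_box (R : realType) (I1 I2 : interval R) :
    set (plane R * plane R) :=
  carleson_square I1 `*` carleson_square I2.

Definition carleson_measure (R : realType) (s a1 a2 : R)
    (mu : set (plane R * plane R) -> \bar R) : Prop :=
  exists C : R, 0 < C /\
    forall I1 I2 : interval R,
      (mu (carleson_box I1 I2) <= C%:E * Vbi a1 a2 (carleson_box I1 I2) `^ s)%E.

(* [differentiable] is taken between normed modules over R[i], i.e. it is
   complex Frechet differentiability. Only the values of f on the product of
   half-planes matter, since this set is open. *)
Definition holomorphic (R : realType) (f : R[i]^o * R[i]^o -> R[i]^o) : Prop :=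
  forall z, bi_upper R z -> differentiable f (to_complex2 z).

Definition integral_abs_powR (R : realType)
    (m : set (plane R * plane R) -> \bar R) (r : R)
    (f : R[i]^o * R[i]^o -> R[i]^o) : \bar R :=
  (\int[m]_(z in bi_upper R) (Normc.normc (f (to_complex2 z)) `^ r)%:E)%E.

Definition bergman (R : realType) (p a1 a2 : R) :
    set (R[i]^o * R[i]^o -> R[i]^o) :=
  [set f | holomorphic f /\ (integral_abs_powR (Vbi a1 a2) p f < +oo)%E].

(* Main.v *)
From HB Require Import structures.
Require Import Defs.
From mathcomp Require Import all_boot all_order all_algebra.
From mathcomp Require Import complex.
From mathcomp Require Import all_classical all_reals all_analysis.
From mathcomp Require Import measurable_realfun ring lra.
Set Implicit Arguments.
Unset Strict Implicit.
Unset Printing Implicit Defensive.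
Import Order.TTheory GRing.Theory Num.Theory.
Import numFieldNormedType.Exports.
Local Open Scope classical_set_scope.
Local Open Scope ring_scope.

(** Both implications compare quantities at the scale of one product box.
    For z = x + iy in the half-plane, [whitney_square z] is a square S(z) with
    centre z and side y / 2. The height is comparable to y on S(z), and both
    V_alpha(S(z)) and V_alpha(Q_I), for |I| comparable to y, are comparable to
    y^(alpha + 2). In two variables [box_weight], written W below, is the
    product of these powers. Put s = q / p.

    From (a) to (b). In one variable, every holomorphic h satisfies
      y^(alpha + 2) |h(z)|^p <= C int_(S(z)) |h|^p dV_alpha
    ([submean_estimate]), and using this in each variable gives
      W(z) |f(z)|^p <= C J(z),   J(z) = int_(S(z1) x S(z2)) |f|^p dV
    ([submean_estimate2]). With B = int |f|^p dV one has J(z) <= B, hence, as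
    s >= 1, |f(z)|^q <= C^s W(z)^(-s) B^(s - 1) J(z). Integrate this against mu
    and exchange the integrals. The points z whose Whitney box contains a given
    w lie in a Carleson box over w with sides 2 Im w1 and 2 Im w2, whose
    mu-measure is at most C W(w)^s by (a), and W(z) is comparable to W(w)
    there. The weights cancel and what remains is B^(s - 1) times B
    ([carleson_embedding]).

    The submean estimate rests on Goursat's theorem, proved for real forms
    P dx + Q dy on rectangles ([goursat]) and then for bounded forms that are
    closed away from one point ([goursat_punctured]). Applied to the imaginary
    part of u (h(z) - h(z0)) / (z - z0) dz, for a suitable constant u, it bounds
    |h(z0)| by integrals of |h| along the sides of a rectangle
    ([cauchy_rectangle]). A choice of sides on which the integral does not
    exceed its average gives an integral over a square ([area_mean_estimate]),
    and an elementary inequality passes from exponent 1 to exponent p.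

    From (b) to (a). The product of the functions (z_j - (u_j - i l_j))^(-n),
    with l_j = |I_j| and u_j in I_j, has modulus at least (3 l1)^(-n)
    (3 l2)^(-n) on Q_R. When n is large, its norm is estimated
    by covering the half-plane with Carleson squares of sides 2^(k + 1) l_j, on
    which the bounds form a geometric series ([integral_pole_kernel_le]). Then
    (b) reduces to (a) by homogeneity ([carleson_necessary]). *)

(** * Integrals over segments *)

Section segment_integral.
Context {R : realType}.
Implicit Types (f g : R -> R) (a b : R).
Local Notation mu := (@lebesgue_measure R).

Definition segment_integral f a b : R := \int[mu]_(x in `[a, b]) f x.

Definition continuous_on_segment f a b :=
  forall x, a <= x <= b -> {for x, continuous f}.

Lemma continuous_on_subsegment f a b a' b' : a <= a' -> b' <= b ->
  continuous_on_segment f a b -> continuous_on_segment f a' b'.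
Proof.
by move=> aa bb cf x /andP[ax xb]; apply: cf; rewrite (le_trans aa)//= (le_trans xb).
Qed.

Lemma integrable_on_segment f a b : continuous_on_segment f a b ->
  mu.-integrable `[a, b] (EFin \o f).
Proof.
move=> cf; apply: continuous_compact_integrable; first exact: segment_compact.
apply: continuous_in_subspaceT => x; rewrite inE /= in_itv/=; exact: cf.
Qed.

Lemma segment_integral_split f a b m : a <= m -> m <= b ->
  continuous_on_segment f a b ->
  segment_integral f a b = segment_integral f a m + segment_integral f m b.
Proof.
move=> am mb cf; have := @Rintegral_itvB _ f (BLeft a) (BRight b) m
  (integrable_on_segment cf).
rewrite !bnd_simp => /(_ am mb) /eqP; rewrite subr_eq => /eqP.
rewrite /segment_integral => ->; rewrite addrC; congr (_ + _).
rewrite Rintegral_itv_obnd_cbnd//.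
apply: integrableS (integrable_on_segment cf) => //.
by apply: subset_itv; rewrite !bnd_simp.
Qed.

Lemma segment_integral_near_cst f a b (k e : R) : a <= b ->
  continuous_on_segment f a b ->
  (forall x, a <= x <= b -> `|f x - k| <= e) ->
  `|segment_integral f a b - k * (b - a)| <= e * (b - a).
Proof.
move=> ab cf fk.
have muab : fine (mu `[a, b]) = b - a.
  by rewrite lebesgue_measure_itv/= lte_fin; case: ltgtP ab => //= -> _; rewrite subrr.
have ci r : mu.-integrable `[a, b] (EFin \o cst r).
  by apply: integrable_on_segment => x _; exact: cst_continuous.
have cfi := integrable_on_segment cf.
have := @le_Rintegral _ _ _ mu `[a, b] f (cst (k + e)) (measurable_itv _) cfi (ci _).
have := @le_Rintegral _ _ _ mu `[a, b] (cst (k - e)) f (measurable_itv _) (ci _) cfi.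
rewrite !Rintegral_cst// muab => h1 h2.
rewrite ler_norml; apply/andP; split.
- rewrite lerBrDr addrC -mulrBl; apply: h1 => x /=; rewrite in_itv/= => /fk.
  by rewrite ler_norml => /andP[+ _]; lra.
- rewrite lerBlDr addrC -mulrDl; apply: h2 => x /=; rewrite in_itv/= => /fk.
  by rewrite ler_norml => /andP[_ +]; lra.
Qed.

Lemma segment_integralB f g a b :
  continuous_on_segment f a b -> continuous_on_segment g a b ->
  segment_integral (fun x => f x - g x) a b =
  segment_integral f a b - segment_integral g a b.
Proof.
by move=> cf cg; rewrite /segment_integral RintegralB//; exact: integrable_on_segment.
Qed.

Lemma le_segment_integral f g a b :
  continuous_on_segment f a b -> continuous_on_segment g a b ->
  (forall x, a <= x <= b -> f x <= g x) ->
  segment_integral f a b <= segment_integral g a b.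
Proof.
move=> cf cg fg; by apply: le_Rintegral => //; exact: integrable_on_segment.
Qed.

End segment_integral.

(** * Circulation of locally closed forms around rectangles *)

Section closed_forms.
Context {R : realType}.
Implicit Types (P Q : R -> R -> R) (a b c d x y : R).

(** The coefficient B is shared by the expansions of P and Q: this says that
    the form P dx + Q dy has exterior derivative 0 at (x, y). *)
Definition locally_closed P Q x y := exists A B D : R, forall e : R, 0 < e ->
  exists2 r : R, 0 < r & forall x' y', `|x' - x| <= r -> `|y' - y| <= r ->
    `|P x' y' - P x y - (A * (x' - x) + B * (y' - y))| <=
      e * (`|x' - x| + `|y' - y|) /\
    `|Q x' y' - Q x y - (B * (x' - x) + D * (y' - y))| <=
      e * (`|x' - x| + `|y' - y|).

(** The integral of P dx + Q dy along the boundary of [a, b] x [c, d], run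
    through counterclockwise. *)
Definition circulation P Q a b c d :=
  segment_integral (P ^~ c) a b - segment_integral (P ^~ d) a b +
  (segment_integral (Q b) c d - segment_integral (Q a) c d).

Lemma continuous_of_linear_bound (f : R -> R) x (k r : R) : 0 < r ->
  (forall x', `|x' - x| <= r -> `|f x' - f x| <= k * `|x' - x|) ->
  {for x, continuous f}.
Proof.
move=> r0 fk; have k0 : 0 <= k.
  have := fk (x + r); rewrite addrAC subrr add0r gtr0_norm// => /(_ (lexx _)).
  by move=> /(le_trans (normr_ge0 _)); rewrite pmulr_lge0.
apply/cvgrPdist_le => /= e e0; near=> x'.
rewrite distrC; apply: (@le_trans _ _ (k * `|x' - x|)).
  by apply: fk; near: x'; apply/nbhs_normP; exists r => //= z /=; rewrite distrC => /ltW.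
apply: (@le_trans _ _ ((k + 1) * (e / (k + 1)))); last first.
  by rewrite mulrCA divff ?mulr1// gt_eqF// ltr_wpDl.
apply: ler_pM => //; first by rewrite lerDl.
near: x'; apply/nbhs_normP; exists (e / (k + 1)) => /=.
  by rewrite divr_gt0// ltr_wpDl.
by move=> z /=; rewrite distrC => /ltW.
Unshelve. all: by end_near. Qed.

Lemma locally_closed_continuous P Q x y : locally_closed P Q x y ->
  {for x, continuous (P ^~ y)} /\ {for y, continuous (Q x)}.
Proof.
move=> [A [B [D /(_ 1 ltr01)[r r0 H]]]]; split.
- apply: (@continuous_of_linear_bound _ _ (1 + `|A|) r) => // x' xr.
  have yr : `|y - y| <= r by rewrite subrr normr0 ltW.
  have [+ _] := H x' y xr yr; rewrite subrr normr0 mulr0 !addr0 mul1r.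
  move=> h; rewrite mulrDl mul1r -normrM.
  by rewrite -[X in `|X|](subrK (A * (x' - x))) (le_trans (ler_normD _ _))// lerD2r.
- apply: (@continuous_of_linear_bound _ _ (1 + `|D|) r) => // y' yr.
  have xr : `|x - x| <= r by rewrite subrr normr0 ltW.
  have [_] := H x y' xr yr; rewrite subrr normr0 mulr0 !add0r mul1r.
  move=> h; rewrite mulrDl mul1r -normrM.
  by rewrite -[X in `|X|](subrK (D * (y' - y))) (le_trans (ler_normD _ _))// lerD2r.
Qed.

Definition closed_form_on P Q a b c d :=
  forall x y, a <= x <= b -> c <= y <= d -> locally_closed P Q x y.

Lemma closed_form_onS P Q a b c d a' b' c' d' :
  a <= a' -> b' <= b -> c <= c' -> d' <= d ->
  closed_form_on P Q a b c d -> closed_form_on P Q a' b' c' d'.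
Proof.
move=> aa bb cc dd H x y /andP[x1 x2] /andP[y1 y2]; apply: H.
  by rewrite (le_trans aa)//= (le_trans x2).
by rewrite (le_trans cc)//= (le_trans y2).
Qed.

Lemma closed_form_continuous_on P Q a b c d : closed_form_on P Q a b c d ->
  (forall y, c <= y <= d -> continuous_on_segment (P ^~ y) a b) /\
  (forall x, a <= x <= b -> continuous_on_segment (Q x) c d).
Proof.
move=> H; split=> [y yi x xi|x xi y yi].
  exact: (locally_closed_continuous (H _ _ xi yi)).1.
exact: (locally_closed_continuous (H _ _ xi yi)).2.
Qed.

Lemma circulation_split_x P Q a m b c d : a <= m -> m <= b ->
  continuous_on_segment (P ^~ c) a b -> continuous_on_segment (P ^~ d) a b ->
  circulation P Q a b c d = circulation P Q a m c d + circulation P Q m b c d.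
Proof.
move=> am mb cc cd; rewrite /circulation (segment_integral_split am mb cc).
by rewrite (segment_integral_split am mb cd); ring.
Qed.

Lemma circulation_split_y P Q a b c m d : c <= m -> m <= d ->
  continuous_on_segment (Q a) c d -> continuous_on_segment (Q b) c d ->
  circulation P Q a b c d = circulation P Q a b c m + circulation P Q a b m d.
Proof.
move=> am mb cc cd; rewrite /circulation (segment_integral_split am mb cc).
by rewrite (segment_integral_split am mb cd); ring.
Qed.

(** The constant terms and those with A and D cancel between opposite sides,
    while the two terms with the shared coefficient B are opposite. The
    error is at most e times the half-perimeter at each point of the boundary. *)
Lemma circulation_small P Q a b c d x y (e r : R) : a <= x <= b -> c <= y <= d ->
  0 <= e -> b - a <= r -> d - c <= r ->
  closed_form_on P Q a b c d ->
  (exists A B D : R, forall x' y', `|x' - x| <= r -> `|y' - y| <= r ->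
    `|P x' y' - P x y - (A * (x' - x) + B * (y' - y))| <=
      e * (`|x' - x| + `|y' - y|) /\
    `|Q x' y' - Q x y - (B * (x' - x) + D * (y' - y))| <=
      e * (`|x' - x| + `|y' - y|)) ->
  `|circulation P Q a b c d| <= 2 * e * (b - a + (d - c)) ^+ 2.
Proof.
move=> xi yi e0 rx ry /closed_form_continuous_on[cP cQ] [A [B [D H]]].
have [ax xb] := andP xi; have [cy yd] := andP yi.
have ab := le_trans ax xb; have cd := le_trans cy yd.
pose s := b - a + (d - c).
have Hs x' y' : a <= x' <= b -> c <= y' <= d ->
    `|P x' y' - P x y - (A * (x' - x) + B * (y' - y))| <= e * s /\
    `|Q x' y' - Q x y - (B * (x' - x) + D * (y' - y))| <= e * s.
  move=> /andP[x1 x2] /andP[y1 y2].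
  have hx : `|x' - x| <= b - a by rewrite ler_norml; lra.
  have hy : `|y' - y| <= d - c by rewrite ler_norml; lra.
  have [h1 h2] := H x' y' (le_trans hx rx) (le_trans hy ry).
  by split; [apply: le_trans h1 _|apply: le_trans h2 _];
    rewrite ler_wpM2l// /s lerD.
have ca : c <= c <= d by rewrite lexx.
have cb : c <= d <= d by rewrite lexx cd.
have aa : a <= a <= b by rewrite lexx.
have bb : a <= b <= b by rewrite lexx ab.
have hP : `|segment_integral (P ^~ c) a b - segment_integral (P ^~ d) a b
     - B * (c - d) * (b - a)| <= 2 * (e * s) * (b - a).
  rewrite -segment_integralB; [|exact: cP..].
  apply: segment_integral_near_cst => // [x' xi'|x' xi'].
    by apply: cvgB; [exact: cP|exact: cP].
  have [h1 _] := Hs x' c xi' ca; have [h2 _] := Hs x' d xi' cb.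
  move: h1 h2; rewrite !ler_norml; lra.
have hQ : `|segment_integral (Q b) c d - segment_integral (Q a) c d
     - B * (b - a) * (d - c)| <= 2 * (e * s) * (d - c).
  rewrite -segment_integralB; [|exact: cQ..].
  apply: segment_integral_near_cst => // [y' yi'|y' yi'].
    by apply: cvgB; [exact: cQ|exact: cQ].
  have [_ h1] := Hs a y' aa yi'; have [_ h2] := Hs b y' bb yi'.
  move: h1 h2; rewrite !ler_norml; lra.
rewrite /circulation -[leRHS]/(2 * e * s ^+ 2).
have -> : 2 * e * s ^+ 2 = 2 * (e * s) * (b - a) + 2 * (e * s) * (d - c) by rewrite /s; ring.
move: hP hQ; rewrite !ler_norml.
set u := segment_integral _ _ _ - _; set v := segment_integral _ _ _ - _.
set K1 := 2 * _ * _; set K2 := 2 * _ * _.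
have -> : B * (c - d) * (b - a) = - (B * (b - a) * (d - c)) by ring.
set w := B * _ * _; lra.
Qed.

End closed_forms.

(** * Goursat's theorem on rectangles *)

Section goursat.
Context {R : realType}.
Implicit Types (P Q : R -> R -> R) (a b c d x y : R).

Lemma nested_segments (a_ b_ : nat -> R) :
  (forall n, a_ n <= a_ n.+1) -> (forall n, b_ n.+1 <= b_ n) ->
  (forall n, a_ n <= b_ n) -> exists x, forall n, a_ n <= x <= b_ n.
Proof.
move=> /nondecreasing_seqP nda /nonincreasing_seqP nib ab.
have bnd m n : a_ m <= b_ n.
  apply: le_trans (nda _ _ (leq_maxl m n)) _.
  by apply: le_trans (ab _) (nib _ _ (leq_maxr m n)).
exists (sup (range a_)) => n; apply/andP; split.
  apply: ub_le_sup; last by exists n.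
  by exists (b_ 0%N) => _ [m _ <-]; exact: bnd.
apply: ge_sup; first by exists (a_ 0%N), 0%N.
by move=> _ [m _ <-]; exact: bnd.
Qed.

(** Circulations add up over the four quarters of the rectangle, so that one of
    them carries at least a quarter of the total. *)
Lemma circulation_quarter P Q a b c d : a <= b -> c <= d ->
  closed_form_on P Q a b c d ->
  exists a' b' c' d', [/\ a <= a' <= b', b' <= b, c <= c' <= d' & d' <= d] /\
   [/\ b' - a' = (b - a) / 2, d' - c' = (d - c) / 2 &
     `|circulation P Q a b c d| <= 4 * `|circulation P Q a' b' c' d'|].
Proof.
move=> ab cd H; have [cP cQ] := closed_form_continuous_on H.
pose m := (a + b) / 2; pose n := (c + d) / 2.
have [am mb] : a <= m /\ m <= b by rewrite /m; split; lra.
have [cn nd] : c <= n /\ n <= d by rewrite /n; split; lra.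
have [q1 [q2 [q3 q4]]] : m - a = (b - a) / 2 /\ b - m = (b - a) / 2 /\
    n - c = (d - c) / 2 /\ d - n = (d - c) / 2.
  by rewrite /m /n; repeat split; lra.
have E : circulation P Q a b c d =
    (circulation P Q a m c n + circulation P Q a m n d) +
    (circulation P Q m b c n + circulation P Q m b n d).
  rewrite (circulation_split_x Q am mb).
  - by congr (_ + _); apply: circulation_split_y => //; apply: cQ; lra.
  - by apply: cP; lra.
  - by apply: cP; lra.
have [h1|h1] := leP `|circulation P Q a b c d| (4 * `|circulation P Q a m c n|).
  by exists a, m, c, n; rewrite ?lexx ?am ?mb ?cn ?nd; split.
have [h2|h2] := leP `|circulation P Q a b c d| (4 * `|circulation P Q a m n d|).
  by exists a, m, n, d; rewrite ?lexx ?am ?mb ?cn ?nd; split.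
have [h3|h3] := leP `|circulation P Q a b c d| (4 * `|circulation P Q m b c n|).
  by exists m, b, c, n; rewrite ?lexx ?am ?mb ?cn ?nd; split.
exists m, b, n, d; rewrite !lexx am mb cn nd; split => //; split => //.
move: h1 h2 h3; rewrite E.
set u1 := circulation _ _ _ _ _ _; set u2 := circulation _ _ _ _ _ _.
set u3 := circulation _ _ _ _ _ _; set u4 := circulation _ _ _ _ _ _.
have := ler_normD (u1 + u2) (u3 + u4); have := ler_normD u1 u2.
have := ler_normD u3 u4; lra.
Qed.

(** Repeated bisection gives rectangles shrinking to a point (x, y), and costs a
    factor 4^n after n steps. By [circulation_small] at (x, y), the circulation
    around the n-th rectangle is at most a small multiple of (s / 2^n)^2, where
    s is the initial half-perimeter, and the powers of 2 cancel. *)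
Theorem goursat P Q a b c d : a <= b -> c <= d ->
  closed_form_on P Q a b c d -> circulation P Q a b c d = 0.
Proof.
move=> ab cd H0.
pose valid (r : (R * R) * (R * R)) :=
  [/\ a <= r.1.1 <= r.1.2, r.1.2 <= b, c <= r.2.1 <= r.2.2 & r.2.2 <= d].
pose step (r s : (R * R) * (R * R)) :=
  [/\ r.1.1 <= s.1.1, s.1.2 <= r.1.2, r.2.1 <= s.2.1 & s.2.2 <= r.2.2] /\
  [/\ s.1.2 - s.1.1 = (r.1.2 - r.1.1) / 2,
      s.2.2 - s.2.1 = (r.2.2 - r.2.1) / 2 &
     `|circulation P Q r.1.1 r.1.2 r.2.1 r.2.2| <=
     4 * `|circulation P Q s.1.1 s.1.2 s.2.1 s.2.2|].
have [F HF] : {F & forall r, valid r -> valid (F r) /\ step r (F r)}.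
  apply: (@choice _ _ (fun r s => valid r -> valid s /\ step r s)) => r.
  have [|nv] := pselect (valid r); last by exists r => /nv.
  move=> [/andP[r1 r2] r3 /andP[r4 r5] r6].
  have [a' [b' [c' [d' [[/andP[s1 s2] s3 /andP[s4 s5] s6] s7]]]]] :=
    circulation_quarter r2 r5 (closed_form_onS r1 r3 r4 r6 H0).
  exists ((a', b'), (c', d')) => _; split; last by split.
  split=> /=; rewrite ?s2 ?s5 ?andbT.
  - exact: le_trans s1.
  - exact: le_trans r3.
  - exact: le_trans s4.
  - exact: le_trans r6.
pose r_ n := iter n F ((a, b), (c, d)).
have v_ n : valid (r_ n).
  elim: n => [|n ih]; first by split; rewrite /= ?lexx.
  exact: (HF _ ih).1.
have st n : step (r_ n) (r_ n.+1) by exact: (HF _ (v_ n)).2.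
have [x Hx] : exists x, forall n, (r_ n).1.1 <= x <= (r_ n).1.2.
  apply: nested_segments => n; [by case: (st n) => -[]..|].
  by case: (v_ n) => /andP[].
have [y Hy] : exists y, forall n, (r_ n).2.1 <= y <= (r_ n).2.2.
  apply: nested_segments => n; [by case: (st n) => -[]..|].
  by case: (v_ n) => _ _ /andP[].
have sz n : [/\ (r_ n).1.2 - (r_ n).1.1 = (b - a) / 2 ^+ n,
    (r_ n).2.2 - (r_ n).2.1 = (d - c) / 2 ^+ n &
    `|circulation P Q a b c d| <= 4 ^+ n *
    `|circulation P Q (r_ n).1.1 (r_ n).1.2 (r_ n).2.1 (r_ n).2.2|].
  elim: n => [|n [ih1 ih2 ih3]]; first by rewrite !expr0 !divr1 mul1r.
  have [_ [-> -> h]] := st n; rewrite ih1 ih2 !exprSr !invfM !mulrA; split => //.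
  by apply: le_trans ih3 _; rewrite -mulrA ler_wpM2l// exprn_ge0.
pose s := b - a + (d - c); have s0 : 0 <= s by rewrite /s; lra.
have key (e : R) : 0 < e -> `|circulation P Q a b c d| <= 2 * e * s ^+ 2.
  move=> e0.
  have [A [B [D /(_ e e0)[r r0 Hr]]]] := H0 x y (Hx 0%N) (Hy 0%N).
  have [n Hn] : exists n, s / 2 ^+ n <= r.
    exists (Num.bound (s / r)); rewrite ler_pdivrMr ?exprn_gt0//.
    rewrite mulrC -ler_pdivrMr//; apply: le_trans (ltW (archi_boundP _)) _.
      by rewrite divr_ge0// ltW.
    by rewrite -natrX ler_nat ltnW// ltn_expl.
  have [z1 z2 z3] := sz n.
  have [/andP[v1 v2] v3 /andP[v4 v5] v6] := v_ n.
  have p2 : 0 < (2 : R) ^+ n by rewrite exprn_gt0.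
  apply: (le_trans z3).
  have -> : 2 * e * s ^+ 2 = 4 ^+ n * (2 * e * (s / 2 ^+ n) ^+ 2).
    have -> : (4 : R) = 2 ^+ 2 by rewrite expr2; lra.
    by rewrite -exprM mulnC exprM; field; rewrite gt_eqF.
  rewrite ler_wpM2l ?exprn_ge0// (_ : s / 2 ^+ n =
    (r_ n).1.2 - (r_ n).1.1 + ((r_ n).2.2 - (r_ n).2.1)); last first.
    by rewrite z1 z2 -mulrDl.
  have zr : (b - a) / 2 ^+ n <= r /\ (d - c) / 2 ^+ n <= r.
    by split; apply: le_trans Hn; rewrite ler_pM2r ?invr_gt0// /s; lra.
  apply: (@circulation_small _ _ _ _ _ _ _ x y e r) => //.
  - exact: ltW.
  - by rewrite z1; exact: zr.1.
  - by rewrite z2; exact: zr.2.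
  - exact: closed_form_onS H0.
  - by exists A, B, D.
apply/eqP; rewrite -normr_le0; apply/ler_addgt0Pr => e e0; rewrite add0r.
apply: le_trans (key (e / (2 * (s ^+ 2 + 1))) _) _.
  by rewrite divr_gt0// mulr_gt0// ltr_wpDl// sqr_ge0.
have q0 : 0 < s ^+ 2 + 1 by rewrite ltr_wpDl// sqr_ge0.
have -> : 2 * (e / (2 * (s ^+ 2 + 1))) * s ^+ 2 = e * (s ^+ 2 / (s ^+ 2 + 1)).
  by field; rewrite gt_eqF.
by rewrite -[leRHS]mulr1 ler_pM2l// ler_pdivrMr// mul1r lerDl.
Qed.

(** The four rectangles that fill the difference avoid (x0, y0), so that
    Goursat's theorem applies to them. *)
Lemma circulation_shrink P Q a b c d x0 y0 a' b' c' d' :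
  a <= a' -> a' < x0 -> x0 < b' -> b' <= b ->
  c <= c' -> c' < y0 -> y0 < d' -> d' <= d ->
  (forall x y, a <= x <= b -> c <= y <= d -> (x, y) != (x0, y0) ->
    locally_closed P Q x y) ->
  circulation P Q a b c d = circulation P Q a' b' c' d'.
Proof.
move=> aa ax xb bb cc cy yd dd H.
have cP y : c <= y <= d -> y != y0 -> continuous_on_segment (P ^~ y) a b.
  move=> yi yy x xi; apply: (locally_closed_continuous (H x y xi yi _)).1.
  by apply: contra yy => /eqP[_ ->].
have cQ x : a <= x <= b -> x != x0 -> continuous_on_segment (Q x) c d.
  move=> xi xx y yi; apply: (locally_closed_continuous (H x y xi yi _)).2.
  by apply: contra xx => /eqP[-> _].
have [ab1 [ab2 ab3]] : a' <= b' /\ a <= b' /\ a' <= b by clear -aa ax xb bb; lra.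
have [cd1 [cd2 cd3]] : c' <= d' /\ c <= d' /\ c' <= d by clear -cc cy yd dd; lra.
have [ab cd] : a <= b /\ c <= d by rewrite (le_trans ab2)// (le_trans cd2).
have H0 a1 b1 c1 d1 : a <= a1 -> a1 <= b1 -> b1 <= b ->
    c <= c1 -> c1 <= d1 -> d1 <= d ->
    (forall x y, a1 <= x <= b1 -> c1 <= y <= d1 -> (x, y) != (x0, y0)) ->
    circulation P Q a1 b1 c1 d1 = 0.
  move=> h1 h2 h3 h4 h5 h6 h7; apply: goursat => // x y xi yi; apply: H.
  - by case/andP: xi => /(le_trans h1) -> /le_trans ->.
  - by case/andP: yi => /(le_trans h4) -> /le_trans ->.
  - exact: h7.
have [c0 d0] : c != y0 /\ d != y0.
  by split; [rewrite lt_eqF ?(le_lt_trans cc)|rewrite gt_eqF ?(lt_le_trans yd)].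
have [a0 b0] : a' != x0 /\ b' != x0 by rewrite (lt_eqF ax) (gt_eqF xb).
rewrite (@circulation_split_x _ P Q a a' b c d)//; first last.
- by apply: cP => //; rewrite cd lexx.
- by apply: cP => //; rewrite cd lexx.
rewrite (@circulation_split_x _ P Q a' b' b c d)//; first last.
- by apply: (@continuous_on_subsegment _ _ a b) => //; apply: cP => //; rewrite cd lexx.
- by apply: (@continuous_on_subsegment _ _ a b) => //; apply: cP => //; rewrite cd lexx.
rewrite (@circulation_split_y _ P Q a' b' c c' d)//; first last.
- by apply: cQ => //; rewrite ab2.
- by apply: cQ => //; rewrite aa.
rewrite (@circulation_split_y _ P Q a' b' c' d' d)//; first last.
- by apply: (@continuous_on_subsegment _ _ c d) => //; apply: cQ => //; rewrite ab2.
- by apply: (@continuous_on_subsegment _ _ c d) => //; apply: cQ => //; rewrite aa.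
rewrite (H0 a a' c d)// => [|x y /andP[_ xa] _]; last first.
  by apply/eqP => -[xx _]; move: xa; rewrite xx leNgt ax.
rewrite (H0 b' b c d)// => [|x y /andP[xa _] _]; last first.
  by apply/eqP => -[xx _]; move: xa; rewrite xx leNgt xb.
rewrite (H0 a' b' c c')// => [|x y _ /andP[_ ya]]; last first.
  by apply/eqP => -[_ yy]; move: ya; rewrite yy leNgt cy.
rewrite (H0 a' b' d' d)// => [|x y _ /andP[ya _]]; last first.
  by apply/eqP => -[_ yy]; move: ya; rewrite yy leNgt yd.
by rewrite !add0r !addr0.
Qed.

(** By [circulation_shrink] the circulation may be computed around small squares
    centred at (x0, y0), whose perimeter tends to 0 while P and Q stay bounded
    on them. *)
Lemma goursat_punctured P Q a b c d x0 y0 (M rho : R) :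
  0 < rho -> a < x0 < b -> c < y0 < d ->
  (forall x y, a <= x <= b -> c <= y <= d -> (x, y) != (x0, y0) ->
    locally_closed P Q x y) ->
  (forall x y, `|x - x0| <= rho -> `|y - y0| <= rho -> (x, y) != (x0, y0) ->
     `|P x y| <= M /\ `|Q x y| <= M) ->
  circulation P Q a b c d = 0.
Proof.
move=> rho0 /andP[ax xb] /andP[cy yd] H HM.
have key (r : R) : 0 < r -> r <= rho -> r <= x0 - a -> r <= b - x0 ->
    r <= y0 - c -> r <= d - y0 -> `|circulation P Q a b c d| <= 8 * M * r.
  move=> r0 rr r1 r2 r3 r4.
  have [a' ea] : exists a', a' = x0 - r by eexists.
  have [b' eb] : exists b', b' = x0 + r by eexists.
  have [c' ec] : exists c', c' = y0 - r by eexists.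
  have [d' ed] : exists d', d' = y0 + r by eexists.
  have [xa xb' yc yd'] : [/\ a' < x0, x0 < b', c' < y0 & y0 < d'].
    by rewrite ea eb ec ed !gtrBl !ltrDl.
  have [aa bb cc dd] : [/\ a <= a', b' <= b, c <= c' & d' <= d].
    by split; rewrite ?ea ?eb ?ec ?ed; [rewrite lerBrDr -lerBrDl|rewrite -lerBrDl|
      rewrite lerBrDr -lerBrDl|rewrite -lerBrDl].
  have [na nb nc nd] : [/\ `|a' - x0| = r, `|b' - x0| = r, `|c' - y0| = r &
      `|d' - y0| = r].
    by rewrite ea eb ec ed; split;
      rewrite addrAC subrr add0r ?normrN gtr0_norm.
  have [a0 b0 c0 d0] : [/\ a' != x0, b' != x0, c' != y0 & d' != y0].
    by split; rewrite ?(lt_eqF xa) ?(gt_eqF xb') ?(lt_eqF yc) ?(gt_eqF yd').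
  rewrite (circulation_shrink aa xa xb' bb cc yc yd' dd H).
  have nearP y : c <= y <= d -> `|y - y0| = r -> y != y0 ->
      `|segment_integral (P ^~ y) a' b'| <= M * (2 * r).
    move=> yi yr yy; have -> : 2 * r = b' - a' by rewrite ea eb; ring.
    have := @segment_integral_near_cst _ (P ^~ y) a' b' 0 M; rewrite mul0r subr0; apply.
    - exact/ltW/(lt_trans xa).
    - move=> x /andP[x1 x2]; apply: (locally_closed_continuous (H x y _ yi _)).1.
        by rewrite (le_trans aa)//= (le_trans x2).
      by apply: contra yy => /eqP[_ ->].
    - move=> x xi; rewrite subr0; apply: (HM x y _ _ _).1; last 2 first.
      + by rewrite yr.
      + by apply: contra yy => /eqP[_ ->].
      by apply: le_trans rr; rewrite ler_distl -ea -eb.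
  have nearQ x : a <= x <= b -> `|x - x0| = r -> x != x0 ->
      `|segment_integral (Q x) c' d'| <= M * (2 * r).
    move=> xi xr xx; have -> : 2 * r = d' - c' by rewrite ec ed; ring.
    have := @segment_integral_near_cst _ (Q x) c' d' 0 M; rewrite mul0r subr0; apply.
    - exact/ltW/(lt_trans yc).
    - move=> y /andP[y1 y2]; apply: (locally_closed_continuous (H x y xi _ _)).2.
        by rewrite (le_trans cc)//= (le_trans y2).
      by apply: contra xx => /eqP[-> _].
    - move=> y yi; rewrite subr0; apply: (HM x y _ _ _).2.
      + by rewrite xr.
      + by apply: le_trans rr; rewrite ler_distl -ec -ed.
      + by apply: contra xx => /eqP[-> _].
  have h1 : `|segment_integral (P ^~ c') a' b'| <= M * (2 * r).
    by apply: nearP => //; rewrite cc (le_trans (ltW (lt_trans yc yd'))).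
  have h2 : `|segment_integral (P ^~ d') a' b'| <= M * (2 * r).
    by apply: nearP => //; rewrite dd (le_trans cc (ltW (lt_trans yc yd'))).
  have h3 : `|segment_integral (Q a') c' d'| <= M * (2 * r).
    by apply: nearQ => //; rewrite aa (le_trans (ltW (lt_trans xa xb'))).
  have h4 : `|segment_integral (Q b') c' d'| <= M * (2 * r).
    by apply: nearQ => //; rewrite bb (le_trans aa (ltW (lt_trans xa xb'))).
  move: h1 h2 h3 h4; rewrite /circulation !ler_norml; clear; lra.
have M0 : 0 <= M.
  have [] := HM (x0 + rho) y0.
  - by rewrite addrAC subrr add0r gtr0_norm.
  - by rewrite subrr normr0 ltW.
  - by apply/eqP => -[/eqP]; rewrite -subr_eq0 addrAC subrr add0r gt_eqF.
  - by move=> /(le_trans (normr_ge0 _)).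
apply/eqP; rewrite -normr_le0; apply/ler_addgt0Pr => e e0; rewrite add0r.
have e1 : 0 < 8 * M + 1 by rewrite ltr_wpDl// mulr_ge0.
have [r [r0 re rr ra [rb rc rd]]] : exists r, [/\ 0 < r, r <= e / (8 * M + 1),
    r <= rho, r <= x0 - a & [/\ r <= b - x0, r <= y0 - c & r <= d - y0]].
  exists (Num.min (e / (8 * M + 1)) (Num.min rho (Num.min (Num.min (x0 - a)
    (b - x0)) (Num.min (y0 - c) (d - y0))))).
  rewrite !lt_min divr_gt0//= rho0 !subr_gt0 ax xb cy yd.
  by rewrite !ge_min !lexx !orbT.
apply: le_trans (key r r0 rr ra rb rc rd) _.
apply: (@le_trans _ _ (8 * M * (e / (8 * M + 1)))).
  by rewrite ler_wpM2l ?mulr_ge0.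
by rewrite mulrCA -[leRHS]mulr1 ler_pM2l// ler_pdivrMr// mul1r lerDl.
Qed.

End goursat.

(** * The modulus in real coordinates *)

Section complex_modulus.
Context {R : realType}.
Implicit Types (z w : R[i]) (x y : R).
Local Notation normc := (@Normc.normc R).

Lemma normc_ge0 z : 0 <= normc z.
Proof. by case: z => x y; exact: sqrtr_ge0. Qed.

Lemma ler_Re_normc z : `|complex.Re z| <= normc z.
Proof.
by case: z => x y /=; rewrite -sqrtr_sqr ler_wsqrtr// lerDl sqr_ge0.
Qed.

Lemma ler_Im_normc z : `|complex.Im z| <= normc z.
Proof.
by case: z => x y /=; rewrite -sqrtr_sqr ler_wsqrtr// lerDr sqr_ge0.
Qed.

Lemma ler_normc_abs x y : normc (x +i* y)%C <= `|x| + `|y|.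
Proof.
rewrite /= -[leRHS]ger0_norm ?addr_ge0// -sqrtr_sqr ler_wsqrtr//.
by rewrite sqrrD !real_normK ?num_real// lerD2r lerDl mulrn_wge0// mulr_ge0.
Qed.

Lemma ler_abs_normc x y : `|x| + `|y| <= 2 * normc (x +i* y)%C.
Proof.
have := ler_Re_normc (x +i* y)%C; have := ler_Im_normc (x +i* y)%C.
by set n := normc _ => /=; lra.
Qed.

Lemma ler_dist_normc (z w : R[i]) : `|normc z - normc w| <= normc (z - w).
Proof.
have h (u v : R[i]) : normc u - normc v <= normc (u - v).
  by rewrite lerBlDr; have := le_normcD (u - v) v; rewrite subrK.
rewrite ler_norml h andbT lerNl opprB (le_trans (h _ _))//.
by rewrite -[normc (w - z)]/(normc (w - z : Rcomplex R)) -normcN opprB.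
Qed.

Lemma normc_real (x : R) : 0 <= x -> normc x%:C%C = x.
Proof. by move=> x0; rewrite /= expr0n/= addr0 sqrtr_sqr ger0_norm. Qed.

Lemma normcX (c : R[i]) n : normc (c ^+ n) = normc c ^+ n.
Proof.
elim: n => [|n ih]; first by rewrite !expr0 Normc.normc1.
by rewrite !exprS Normc.normcM ih.
Qed.

End complex_modulus.

(** * Complex differentiability in real coordinates *)

Section complex_differentiability.
Context {R : realType}.
Implicit Types (g : R[i]^o -> R[i]^o) (x y : R).
Local Notation normc := (@Normc.normc R).
Local Notation cplx x y := ((x +i* y)%C : R[i]^o).

Lemma complex_linear_approx g x y : derivable g (cplx x y) 1 ->
  exists c : R[i], forall e : R, 0 < e -> exists2 r : R, 0 < r &
  forall x' y', `|x' - x| <= r -> `|y' - y| <= r ->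
    normc (g (cplx x' y') - g (cplx x y) - c * cplx (x' - x) (y' - y)) <=
    e * (`|x' - x| + `|y' - y|).
Proof.
move=> /cvg_ex[/= c /cvgrPdist_le/= H]; exists c => e e0.
have e0' : (0 : R[i]) < e%:C%C by rewrite ltcR.
have /nbhs_normP[/= d d0 Hd] := H _ e0'.
have [r dE r0] : exists2 r : R, d = r%:C%C & 0 < r.
  exists (complex.Re d); first by rewrite RRe_real// gtr0_real.
  by move: d0; rewrite ltcE => /andP[].
exists (r / 4) => [|x' y' hx hy]; first by rewrite divr_gt0.
have [/eqP t0|t0] := boolP (cplx (x' - x) (y' - y) == 0).
  have /eqP := t0; rewrite eq_complex/= !subr_eq0 => /andP[/eqP -> /eqP ->].
  by rewrite !subrr/= mulr0 subrr Normc.normc0 normr0 addr0 mulr0.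
set t := cplx (x' - x) _ in t0 *.
have Ht : normc t <= `|x' - x| + `|y' - y| by exact: ler_normc_abs.
have tx : t + cplx x y = cplx x' y' by rewrite /t/=; simpc; rewrite !subrK.
have := Hd t; rewrite /ball_/= sub0r normrN dE -[`|t|]/(normc t)%:C%C ltcR.
move=> /(_ _ t0); rewrite -[t%:A]/(t * 1) mulr1 tx.
set G := g _ - g _.
rewrite -[`|_|]/(normc (c - t^-1 * G))%:C%C lecR => Hc.
apply: (@le_trans _ _ (e * normc t)); last by rewrite ler_wpM2l// ltW.
have -> : G - c * t = - (c - t^-1 * G) * t.
  by rewrite opprB mulrBl mulrAC mulVf// mul1r.
rewrite Normc.normcM -[normc (- _)]/(normc (- _ : Rcomplex R)) normcN.
rewrite ler_wpM2r ?normc_ge0//; apply: Hc.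
by apply: le_lt_trans Ht _; move: hx hy r0; clear; lra.
Qed.

Lemma complex_lipschitz_at g x y : derivable g (cplx x y) 1 ->
  exists k r : R, 0 < r /\ forall x' y', `|x' - x| <= r -> `|y' - y| <= r ->
    normc (g (cplx x' y') - g (cplx x y)) <= k * (`|x' - x| + `|y' - y|).
Proof.
move=> /complex_linear_approx[c /(_ 1 ltr01)[r r0 H]].
exists (1 + normc c), r; split => // x' y' hx hy.
set G := g _ - g _; set t := cplx (x' - x) (y' - y).
have -> : G = (G - c * t) + c * t by rewrite subrK.
apply: le_trans (le_normcD _ _) _; rewrite mulrDl lerD//; first exact: H.
by rewrite Normc.normcM ler_wpM2l ?normc_ge0// ler_normc_abs.
Qed.

Lemma continuous_normc_x g x y : derivable g (cplx x y) 1 ->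
  {for x, continuous (fun x' => normc (g (cplx x' y)))}.
Proof.
move=> /complex_lipschitz_at[k [r [r0 H]]].
apply: (continuous_of_linear_bound r0) => x' hx.
have yr : `|y - y| <= r by rewrite subrr normr0 ltW.
apply: le_trans (ler_dist_normc _ _) _; apply: le_trans (H x' y hx yr) _.
by rewrite subrr normr0 addr0.
Qed.

Lemma continuous_normc_y g x y : derivable g (cplx x y) 1 ->
  {for y, continuous (fun y' => normc (g (cplx x y')))}.
Proof.
move=> /complex_lipschitz_at[k [r [r0 H]]].
apply: (continuous_of_linear_bound r0) => y' hy.
have xr : `|x - x| <= r by rewrite subrr normr0 ltW.
apply: le_trans (ler_dist_normc _ _) _; apply: le_trans (H x y' xr hy) _.
by rewrite subrr normr0 add0r.
Qed.

(** Im (g dz) = Im g dx + Re g dy. If the derivative of g is c1 + i c2, then the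
    partial derivatives of (Im g, Re g) are c2, c1 in x and c1, - c2 in y: the
    Cauchy-Riemann equations are the symmetry of this matrix. *)
Lemma locally_closed_Im g x y : derivable g (cplx x y) 1 ->
  locally_closed (fun x y => complex.Im (g (cplx x y)))
                 (fun x y => complex.Re (g (cplx x y))) x y.
Proof.
move=> /complex_linear_approx[[c1 c2] H].
exists c2, c1, (- c2) => e e0; have [r r0 Hr] := H e e0; exists r => // x' y' hx hy.
have := Hr x' y' hx hy; move: (g _) (g _) => [u v] [u' v'].
set N := normc _ => HN; split; apply: le_trans HN.
- apply: le_trans (ler_Im_normc _); rewrite le_eqVlt; apply/orP; left.
  by apply/eqP; congr (`|_|) => /=; ring.
- apply: le_trans (ler_Re_normc _); rewrite le_eqVlt; apply/orP; left.
  by apply/eqP; congr (`|_|) => /=; ring.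
Qed.

End complex_differentiability.

(** * Cauchy's estimate on rectangles *)

Section cauchy_estimate.
Context {R : realType}.
Implicit Types (h : R[i]^o -> R[i]^o) (x y a b c d : R).
Local Notation normc := (@Normc.normc R).
Local Notation cplx x y := ((x +i* y)%C : R[i]^o).

(** The sign s accounts for the orientation of one side of a rectangle, and m
    for the part of the integrand that is bounded away from 0. *)
Lemma le_segment_integral_affine (f g : R -> R) a b (s k m : R) : a <= b ->
  continuous_on_segment f a b -> continuous_on_segment g a b ->
  (forall x, a <= x <= b -> s * f x <= k * g x - m) ->
  s * segment_integral f a b <= k * segment_integral g a b - m * (b - a).
Proof.
move=> ab cf cg fg.
have cZ (e : R) (f0 : R -> R) : continuous_on_segment f0 a b ->
    continuous_on_segment (fun x => e * f0 x) a b.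
  by move=> cf0 x xi; apply: cvgM; [exact: cvg_cst|exact: cf0].
have cm : continuous_on_segment (fun=> m) a b by move=> x _; exact: cvg_cst.
have sZ (e : R) (f0 : R -> R) : continuous_on_segment f0 a b ->
    segment_integral (fun x => e * f0 x) a b = e * segment_integral f0 a b.
  move=> cf0; rewrite /segment_integral RintegralZl//.
  exact: integrable_on_segment.
rewrite -!sZ//.
apply: (@le_trans _ _ (segment_integral (fun x => k * g x - m) a b)).
  apply: le_segment_integral => //; first exact: cZ.
  by move=> x xi; apply: cvgB; [exact: cZ|exact: cm].
rewrite segment_integralB//; last exact: cZ.
rewrite lerD2l lerN2.
have : `|segment_integral (fun=> m) a b - m * (b - a)| <= 0 * (b - a).
  by apply: segment_integral_near_cst => // x _; rewrite subrr normr0.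
by rewrite mul0r normr_le0 subr_eq0 => /eqP ->.
Qed.

(** The integrand of Cauchy's formula with its pole removed. The constant u is
    there to make u h(z0) real and nonnegative. As 0^-1 = 0, the value at z0 is
    0, so that the quotient may be discontinuous there. *)
Definition cauchy_quotient (u : R[i]) h x0 y0 : R[i]^o -> R[i]^o :=
  fun z => u * ((h z - h (cplx x0 y0)) * (z - cplx x0 y0)^-1).

Lemma derivable_cauchy_quotient u h x0 y0 x y : (x, y) != (x0, y0) ->
  derivable h (cplx x y) 1 ->
  derivable (cauchy_quotient u h x0 y0) (cplx x y) 1.
Proof.
move=> xy dh.
have dc (k : R[i]^o) : derivable (fun _ : R[i]^o => k) (cplx x y) 1.
  exact: derivable_cst.
have dnum := derivableB dh (dc (h (cplx x0 y0))).
have dden := derivableB (@derivable_id _ _ (cplx x y) 1) (dc (cplx x0 y0)).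
have z0 : (id - (fun=> (x0 +i* y0)%C)) (x +i* y)%C != 0 :> R[i].
  apply/eqP => e0; have /subr0_eq : (x +i* y)%C - (x0 +i* y0)%C = 0 :> R[i] := e0.
  by case=> e1 e2; move: xy; rewrite e1 e2 eqxx.
exact: (derivableM (dc u) (derivableM dnum (derivableV z0 dden))).
Qed.

Lemma cauchy_quotient_bounded u h x0 y0 : derivable h (cplx x0 y0) 1 ->
  exists M r : R, 0 < r /\ forall x y, `|x - x0| <= r -> `|y - y0| <= r ->
    (x, y) != (x0, y0) -> normc (cauchy_quotient u h x0 y0 (cplx x y)) <= M.
Proof.
move=> /complex_lipschitz_at[k [r [r0 H]]].
exists (normc u * (2 * k)), r; split => // x y hx hy xy.
rewrite /cauchy_quotient Normc.normcM ler_wpM2l ?normc_ge0//.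
rewrite Normc.normcM Normc.normcV.
have xy' : cplx x y - cplx x0 y0 != 0.
  by rewrite subr_eq0 eq_complex/=; apply: contra xy => /andP[/eqP -> /eqP ->].
have n0 : 0 < normc (cplx x y - cplx x0 y0).
  by rewrite lt_neqAle normc_ge0 andbT eq_sym; apply: contra xy' => /eqP/Normc.eq0_normc ->.
rewrite ler_pdivrMr//; apply: le_trans (H x y hx hy) _.
have := ler_abs_normc (x - x0) (y - y0).
have k0 : 0 <= k.
  have := le_trans (normc_ge0 _) (H (x0 + r) y0 _ _).
  rewrite [x0 + r]addrC addrK subrr normr0 addr0 pmulr_lge0 ?gtr0_norm//.
  by apply; rewrite ?lexx// ltW.
move=> /(ler_wpM2l k0) /le_trans; apply.
by rewrite mulrA [k * 2]mulrC.
Qed.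

(** Up to sign, s / (s^2 + t^2) is the component of 1 / (z - z0) that is
    integrated along a side at distance s from z0, where t is the other
    coordinate of z - z0. *)
Lemma ler_div_sqr (s t r : R) : 0 < r -> r / 2 <= s <= r -> `|t| <= r ->
  (4 * r)^-1 <= s / (s ^+ 2 + t ^+ 2).
Proof.
move=> r0 /andP[rs sr] tr; have s0 : 0 < s by apply: lt_le_trans rs; rewrite divr_gt0.
have q0 : 0 < s ^+ 2 + t ^+ 2 by rewrite ltr_pwDl ?exprn_gt0 ?sqr_ge0.
rewrite ler_pdivlMr// mulrC ler_pdivrMr ?mulr_gt0//.
have t2 : t ^+ 2 <= r ^+ 2.
  by rewrite -[t ^+ 2]real_normK ?num_real// lerXn2r ?nnegrE// ltW.
have s2 : s ^+ 2 <= r ^+ 2 by rewrite lerXn2r ?nnegrE// ltW.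
have : r * (r / 2) <= r * s by rewrite ler_pM2l.
move: t2 s2; rewrite !expr2; lra.
Qed.

(** By [goursat_punctured] the circulation of Im (u h(z) / (z - z0) dz) equals
    that of |h(z0)| Im (dz / (z - z0)). Each side contributes at least
    |h(z0)| / 4 to the latter by [ler_div_sqr], which replaces the exact value
    2 pi of the circulation of dz / (z - z0); it contributes at most 2 / r
    times an integral of |h| to the former. The position of each side is free
    in an interval of length r / 2, so that the sides can be chosen later. *)
Lemma cauchy_rectangle h x0 y0 r a b c d : 0 < r ->
  (forall x y, `|x - x0| <= r -> `|y - y0| <= r -> derivable h (cplx x y) 1) ->
  x0 - r <= a <= x0 - r / 2 -> x0 + r / 2 <= b <= x0 + r ->
  y0 - r <= c <= y0 - r / 2 -> y0 + r / 2 <= d <= y0 + r ->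
  r * normc (h (cplx x0 y0)) <=
  2 * (segment_integral (fun x => normc (h (cplx x c))) a b +
       segment_integral (fun x => normc (h (cplx x d))) a b +
       segment_integral (fun y => normc (h (cplx a y))) c d +
       segment_integral (fun y => normc (h (cplx b y))) c d).
Proof.
move=> r0 dh ha hb hc hd.
have [n0 En0] : exists n0 : R, n0 = normc (h (cplx x0 y0)) by eexists.
have n0_ge0 : 0 <= n0 by rewrite En0 normc_ge0.
have [u [u1 uh]] : exists u : R[i], normc u <= 1 /\ u * h (cplx x0 y0) = n0%:C%C.
  have [h0|h0] := eqVneq (h (cplx x0 y0)) 0.
    by exists 0; rewrite mul0r Normc.normc0 En0 h0 Normc.normc0.
  exists (n0%:C%C / h (cplx x0 y0)); split; last by rewrite divfK.
  rewrite Normc.normcM Normc.normcV normc_real// -En0.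
  by have [->|?] := eqVneq n0 0; rewrite ?mul0r// divff.
pose g := cauchy_quotient u h x0 y0.
have xr x : a <= x <= b -> `|x - x0| <= r.
  by rewrite ler_norml; move: ha hb; clear; lra.
have yr y : c <= y <= d -> `|y - y0| <= r.
  by rewrite ler_norml; move: hc hd; clear; lra.
have dg x y : a <= x <= b -> c <= y <= d -> (x, y) != (x0, y0) ->
    derivable g (cplx x y) 1.
  by move=> xi yi xy; apply: derivable_cauchy_quotient => //; apply: dh; [exact: xr|exact: yr].
have [M [r' [r'0 HM]]] : exists M r : R, 0 < r /\
    forall x y, `|x - x0| <= r -> `|y - y0| <= r ->
    (x, y) != (x0, y0) -> normc (g (cplx x y)) <= M.
  by apply: cauchy_quotient_bounded; apply: dh; rewrite subrr normr0 ltW.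
have axb : a < x0 < b by move: ha hb r0; clear; lra.
have cyd : c < y0 < d by move: hc hd r0; clear; lra.
have H0 := @goursat_punctured _ (fun x y => complex.Im (g (cplx x y)))
  (fun x y => complex.Re (g (cplx x y))) a b c d x0 y0 M r' r'0 axb cyd
  (fun x y hx hy hxy => locally_closed_Im (dg x y hx hy hxy))
  (fun x y hx hy hxy => conj (le_trans (ler_Im_normc _) (HM x y hx hy hxy))
                             (le_trans (ler_Re_normc _) (HM x y hx hy hxy))).
have gE x y : g (cplx x y) =
    u * h (cplx x y) / cplx (x - x0) (y - y0) - n0%:C%C / cplx (x - x0) (y - y0).
  by rewrite /g /cauchy_quotient -uh -mulrBl -mulrBr -mulrA.
have far (s t : R) : r / 2 <= `|s| \/ r / 2 <= `|t| -> r / 2 <= normc (cplx s t).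
  move=> [/le_trans -> //|/le_trans -> //]; first exact: (ler_Re_normc (cplx s t)).
  exact: (ler_Im_normc (cplx s t)).
have main (z : R[i]) s t : r / 2 <= normc (cplx s t) ->
   normc (u * z / cplx s t) <= 2 / r * normc z.
  move=> hst; have st0 : 0 < normc (cplx s t) by apply: lt_le_trans hst; rewrite divr_gt0.
  rewrite !Normc.normcM Normc.normcV mulrC; apply: ler_pM.
  - by rewrite invr_ge0 normc_ge0.
  - by rewrite mulr_ge0 ?normc_ge0.
  - by rewrite -[2 / r]invf_div lef_pV2// posrE divr_gt0.
  - by rewrite ler_piMl ?normc_ge0.
have ReV s t : complex.Re (n0%:C%C / cplx s t) = n0 * (s / (s ^+ 2 + t ^+ 2)).
  by rewrite /=; ring.
have ImV s t : complex.Im (n0%:C%C / cplx s t) = n0 * (- t / (s ^+ 2 + t ^+ 2)).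
  by rewrite /=; ring.
have ReB (z w : R[i]) : complex.Re (z - w) = complex.Re z - complex.Re w by case: z; case: w.
have ImB (z w : R[i]) : complex.Im (z - w) = complex.Im z - complex.Im w by case: z; case: w.
pose N x y : R := normc (h (cplx x y)); pose m : R := n0 * (4 * r)^-1.
have cNx y : c <= y <= d -> continuous_on_segment (N ^~ y) a b.
  by move=> yi x xi; apply: continuous_normc_x; apply: dh; [exact: xr|exact: yr].
have cNy x : a <= x <= b -> continuous_on_segment (N x) c d.
  by move=> xi y yi; apply: continuous_normc_y; apply: dh; [exact: xr|exact: yr].
have cP y : c <= y <= d -> y != y0 ->
    continuous_on_segment (fun x => complex.Im (g (cplx x y))) a b.
  move=> yi yy x xi; apply: (locally_closed_continuous (locally_closed_Im (dg x y xi yi _))).1.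
  by apply: contra yy => /eqP[_ ->].
have cQ x : a <= x <= b -> x != x0 ->
    continuous_on_segment (fun y => complex.Re (g (cplx x y))) c d.
  move=> xi xx y yi; apply: (locally_closed_continuous (locally_closed_Im (dg x y xi yi _))).2.
  by apply: contra xx => /eqP[-> _].
have ab : a <= b by move: axb; clear; lra.
have cd : c <= d by move: cyd; clear; lra.
have bnd (z e : R) : `|z| <= e -> z <= e /\ - z <= e by rewrite ler_norml; clear; lra.
have r2 : 0 < r / 2 by rewrite divr_gt0.
have right : 1 * segment_integral (fun y => complex.Re (g (cplx b y))) c d <=
    2 / r * segment_integral (N b) c d - m * (d - c).
  apply: le_segment_integral_affine => //.
  - by apply: cQ; rewrite ?ab ?lexx// gt_eqF//; case/andP: axb.
  - by apply: cNy; rewrite ab lexx.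
  move=> y yi; rewrite mul1r gE ReB; apply: lerB.
  - apply: le_trans (main (h (cplx b y)) (b - x0) (y - y0) _).
      exact: (bnd _ _ (ler_Re_normc _)).1.
    apply: far; left; rewrite ger0_norm; move: hb r2; clear; lra.
  - rewrite ReV ler_wpM2l//;
      apply: ler_div_sqr => //; last exact: yr.
    by move: hb; clear; lra.
have left : -1 * segment_integral (fun y => complex.Re (g (cplx a y))) c d <=
    2 / r * segment_integral (N a) c d - m * (d - c).
  apply: le_segment_integral_affine => //.
  - by apply: cQ; rewrite ?ab ?lexx// lt_eqF//; case/andP: axb.
  - by apply: cNy; rewrite ab lexx.
  move=> y yi; rewrite mulN1r gE ReB opprD; apply: lerB.
  - apply: le_trans (main (h (cplx a y)) (a - x0) (y - y0) _).
      exact: (bnd _ _ (ler_Re_normc _)).2.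
    apply: far; left; rewrite ler0_norm; move: ha r2; clear; lra.
  - rewrite ReV -mulrN -mulNr ler_wpM2l// -(sqrrN (a - x0));
      apply: ler_div_sqr => //; last exact: yr.
    by move: ha; clear; lra.
have bottom : 1 * segment_integral (fun x => complex.Im (g (cplx x c))) a b <=
    2 / r * segment_integral (N ^~ c) a b - m * (b - a).
  apply: le_segment_integral_affine => //.
  - by apply: cP; rewrite ?cd ?lexx// lt_eqF//; case/andP: cyd.
  - by apply: cNx; rewrite cd lexx.
  move=> x xi; rewrite mul1r gE ImB; apply: lerB.
  - apply: le_trans (main (h (cplx x c)) (x - x0) (c - y0) _).
      exact: (bnd _ _ (ler_Im_normc _)).1.
    apply: far; right; rewrite ler0_norm; move: hc r2; clear; lra.
  - rewrite ImV ler_wpM2l// [_ ^+ 2 + _]addrC -(sqrrN (c - y0));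
      apply: ler_div_sqr => //; last exact: xr.
    by move: hc; clear; lra.
have top : -1 * segment_integral (fun x => complex.Im (g (cplx x d))) a b <=
    2 / r * segment_integral (N ^~ d) a b - m * (b - a).
  apply: le_segment_integral_affine => //.
  - by apply: cP; rewrite ?cd ?lexx// gt_eqF//; case/andP: cyd.
  - by apply: cNx; rewrite cd lexx.
  move=> x xi; rewrite mulN1r gE ImB opprD; apply: lerB.
  - apply: le_trans (main (h (cplx x d)) (x - x0) (d - y0) _).
      exact: (bnd _ _ (ler_Im_normc _)).2.
    apply: far; right; rewrite ger0_norm; move: hd r2; clear; lra.
  - rewrite ImV -mulrN -mulNr opprK ler_wpM2l// [_ ^+ 2 + _]addrC;
      apply: ler_div_sqr => //; last exact: xr.
    by move: hd; clear; lra.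
have m0 : 0 <= m by rewrite mulr_ge0// invr_ge0 mulr_ge0// ltW.
have n0E : n0 = 4 * (m * r) by rewrite /m; field; rewrite gt_eqF.
have m1 : m * r <= m * (b - a) by rewrite ler_wpM2l//; move: ha hb; clear; lra.
have m2 : m * r <= m * (d - c) by rewrite ler_wpM2l//; move: hc hd; clear; lra.
have sum : n0 <= 2 / r * (segment_integral (N ^~ c) a b + segment_integral (N ^~ d) a b
    + segment_integral (N a) c d + segment_integral (N b) c d).
  move: right left bottom top m1 m2 H0; rewrite /circulation !mul1r !mulN1r.
  by rewrite n0E !mulrDr; clear; lra.
by rewrite -En0 -ler_pdivlMl// mulrA [_^-1 * 2]mulrC.
Qed.

End cauchy_estimate.

(** * From integrals over sides to integrals over squares *)

Section area_mean.
Context {R : realType}.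
Implicit Types (h : R[i]^o -> R[i]^o) (x y a b c d : R).
Local Notation normc := (@Normc.normc R).
Local Notation cplx x y := ((x +i* y)%C : R[i]^o).
Local Notation leb := (@lebesgue_measure R).

Lemma exists_lt_of_integral_lt (G : measurableTypeR R -> \bar R) a b (t : R) :
  a < b -> 0 <= t -> measurable_fun [set: measurableTypeR R] G ->
  (forall x, 0 <= G x)%E ->
  (\int[leb]_x G x < (t * (b - a))%:E)%E ->
  exists2 c, a <= c <= b & (G c < t%:E)%E.
Proof.
move=> ab t0 mG G0; apply: contraPP => /forall2NP H; apply/negP; rewrite -leNgt.
apply: (@le_trans _ _ (\int[leb]_(x in `[a, b]) G x)%E); last first.
  by apply: ge0_subset_integral => //; exact: measurableT.
apply: (@le_trans _ _ (\int[leb]_(x in `[a, b]) (cst t%:E x))%E).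
  rewrite integral_cst//= lebesgue_measure_itv/= lte_fin ab.
  by rewrite -EFinB -EFinM.
apply: ge0_le_integral => //.
- exact: measurable_funTS.
- move=> x /=; rewrite in_itv/= => xi.
  by have [//|/negP] := H x; rewrite -leNgt.
Qed.

Lemma lebesgue2_fubini1 (F : plane R -> \bar R) :
  measurable_fun [set: plane R] F -> (forall z, 0 <= F z)%E ->
  (\int[lebesgue2 R]_z F z = \int[leb]_x \int[leb]_y F (x, y))%E.
Proof. by move=> mF F0; rewrite /lebesgue2 fubini_tonelli1. Qed.

Lemma lebesgue2_fubini2 (F : plane R -> \bar R) :
  measurable_fun [set: plane R] F -> (forall z, 0 <= F z)%E ->
  (\int[lebesgue2 R]_z F z = \int[leb]_y \int[leb]_x F (x, y))%E.
Proof. by move=> mF F0; rewrite /lebesgue2 fubini_tonelli2. Qed.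

Lemma segment_integral_le_integral (f : R -> R) (G : measurableTypeR R -> \bar R) a b (t : R) :
  continuous_on_segment f a b -> measurable_fun [set: measurableTypeR R] G ->
  (forall x, 0 <= G x)%E -> (forall x, a <= x <= b -> G x = (f x)%:E) ->
  (\int[leb]_x G x < t%:E)%E -> segment_integral f a b < t.
Proof.
move=> cf mG G0 Gf It; rewrite -lte_fin; apply: le_lt_trans It.
rewrite fineK; last by apply: integrable_fin_num => //; exact: integrable_on_segment.
rewrite (@eq_integral _ _ _ _ _ G); last first.
  by move=> x; rewrite inE/= in_itv/= => /Gf.
by apply: ge0_subset_integral => //; exact: measurableT.
Qed.

(** If the bound failed, then in each of the four strips at distance between
    r / 2 and r of the centre there would be a segment with an integral of |h|
    less than r |h(z0)| / 8, and these four segments would bound a rectangle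
    that contradicts [cauchy_rectangle]. F is |h| on the square, extended to a
    measurable function on the plane. *)
Lemma area_mean_estimate h x0 y0 (r : R) (F : plane R -> \bar R) : 0 < r ->
  (forall x y, `|x - x0| <= r -> `|y - y0| <= r -> derivable h (cplx x y) 1) ->
  measurable_fun [set: plane R] F -> (forall z, 0 <= F z)%E ->
  (forall x y, `|x - x0| <= r -> `|y - y0| <= r ->
     F (x, y) = (normc (h (cplx x y)))%:E) ->
  ((r ^+ 2 * normc (h (cplx x0 y0)))%:E <= 16%:E * \int[lebesgue2 R]_z F z)%E.
Proof.
move=> r0 dh mF F0 Fh; rewrite leNgt; apply/negP => lt16.
have [n0 En0] : exists n0 : R, n0 = normc (h (cplx x0 y0)) by eexists.
have n0_ge0 : 0 <= n0 by rewrite En0 normc_ge0.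
pose t := r * n0 / 8; have t0 : 0 <= t by rewrite divr_ge0// mulr_ge0// ltW.
have It : (\int[lebesgue2 R]_z F z < (t * (r / 2))%:E)%E.
  rewrite -(@lte_pmul2l _ 16%:E)// -EFinM (lt_le_trans lt16)// lee_fin -En0 /t.
  by rewrite le_eqVlt; apply/orP; left; apply/eqP; field.
have mFx y : measurable_fun [set: measurableTypeR R] (fun x => F (x, y)).
  exact: measurableT_comp mF (pair2_measurable y).
have mFy x : measurable_fun [set: measurableTypeR R] (fun y => F (x, y)).
  exact: measurableT_comp mF (pair1_measurable x).
pose Bx y := (\int[leb]_x F (x, y))%E; pose By x := (\int[leb]_y F (x, y))%E.
have Bx0 y : (0 <= Bx y)%E by apply: integral_ge0 => x _.
have By0 x : (0 <= By x)%E by apply: integral_ge0 => y _.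
have mBx : measurable_fun [set: measurableTypeR R] Bx.
  exact: (@measurable_fun_fubini_tonelli_G _ _ _ _ _ leb F).
have mBy : measurable_fun [set: measurableTypeR R] By.
  exact: (@measurable_fun_fubini_tonelli_F _ _ _ _ _ leb F).
have IBx a b : b - a = r / 2 -> (\int[leb]_x Bx x < (t * (b - a))%:E)%E.
  by move=> ->; rewrite /Bx -lebesgue2_fubini2.
have IBy a b : b - a = r / 2 -> (\int[leb]_x By x < (t * (b - a))%:E)%E.
  by move=> ->; rewrite /By -lebesgue2_fubini1.
have lt2 (s u : R) : u - s = r / 2 -> s < u.
  by rewrite -[s < u]subr_gt0 => ->; rewrite divr_gt0.
have e1 (s : R) : s - r / 2 - (s - r) = r / 2 by field.
have e2 (s : R) : s + r - (s + r / 2) = r / 2 by field.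
have [c hc Bc] := exists_lt_of_integral_lt (lt2 _ _ (e1 y0)) t0 mBx Bx0 (IBx _ _ (e1 y0)).
have [d hd Bd] := exists_lt_of_integral_lt (lt2 _ _ (e2 y0)) t0 mBx Bx0 (IBx _ _ (e2 y0)).
have [a ha Ba] := exists_lt_of_integral_lt (lt2 _ _ (e1 x0)) t0 mBy By0 (IBy _ _ (e1 x0)).
have [b hb Bb] := exists_lt_of_integral_lt (lt2 _ _ (e2 x0)) t0 mBy By0 (IBy _ _ (e2 x0)).
have xr x : a <= x <= b -> `|x - x0| <= r.
  by rewrite ler_norml; move: ha hb; clear; lra.
have yr y : c <= y <= d -> `|y - y0| <= r.
  by rewrite ler_norml; move: hc hd; clear; lra.
have sx y : c <= y <= d -> (Bx y < t%:E)%E ->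
    segment_integral (fun x => normc (h (cplx x y))) a b < t.
  move=> yi; apply: segment_integral_le_integral => //.
  - by move=> x xi; apply: continuous_normc_x; apply: dh; [exact: xr|exact: yr].
  - by move=> x xi; apply: Fh; [exact: xr|exact: yr].
have sy x : a <= x <= b -> (By x < t%:E)%E ->
    segment_integral (fun y => normc (h (cplx x y))) c d < t.
  move=> xi; apply: segment_integral_le_integral => //.
  - by move=> y yi; apply: continuous_normc_y; apply: dh; [exact: xr|exact: yr].
  - by move=> y yi; apply: Fh; [exact: xr|exact: yr].
have ab : a <= b by move: ha hb r0; clear; lra.
have cd : c <= d by move: hc hd r0; clear; lra.
have hsum := cauchy_rectangle r0 dh ha hb hc hd.
have := sx c; have := sx d; have := sy a; have := sy b.
rewrite !lexx ab cd => /(_ isT Bb) h1 /(_ isT Ba) h2 /(_ isT Bd) h3 /(_ isT Bc) h4.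
move: hsum h1 h2 h3 h4; rewrite -En0.
have -> : r * n0 = 8 * t by rewrite /t; field.
by clear; lra.
Qed.

End area_mean.

(** * Measurability of holomorphic functions *)

Section measurability.
Context {R : realType}.
Local Notation normc := (@Normc.normc R).
Local Notation biplane := (plane R * plane R)%type.

Definition open_box (q : biplane) (r : R) : set biplane :=
  [set w | [/\ `|w.1.1 - q.1.1| < r, `|w.1.2 - q.1.2| < r,
               `|w.2.1 - q.2.1| < r & `|w.2.2 - q.2.2| < r]].

Lemma measurable_open_box q r : measurable (open_box q r).
Proof.
have bE (x c : R) : (`|x - c| < r) = (x \in `]c - r, c + r[).
  by rewrite in_itv/= ltr_distl.
rewrite (_ : open_box q r =
  (`]q.1.1 - r, q.1.1 + r[ `*` `]q.1.2 - r, q.1.2 + r[) `*`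
  (`]q.2.1 - r, q.2.1 + r[ `*` `]q.2.2 - r, q.2.2 + r[)).
  by do 2!apply: measurableX => //; apply: measurableX.
apply/seteqP; split=> -[[a b] [c d]]; rewrite /open_box/= !bE.
  by case.
by move=> [[? ?] [? ?]].
Qed.

(** Such a set is a countable union of boxes with rational centres and with
    half-sides 1 / (n + 1). *)
Lemma measurable_of_open_boxes (A : set biplane) :
  (forall z, A z -> exists2 r : R, 0 < r & open_box z r `<=` A) -> measurable A.
Proof.
move=> HA.
pose box (i : ((rat * rat) * (rat * rat)) * nat) : set biplane :=
  open_box ((ratr i.1.1.1, ratr i.1.1.2), (ratr i.1.2.1, ratr i.1.2.2)) i.2.+1%:R^-1.
rewrite (_ : A = \bigcup_(i in [set: ((rat * rat) * (rat * rat)) * nat])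
    (if `[< box i `<=` A >] then box i else set0)).
  apply: countable_bigcupT_measurable => // i.
  by case: ifP => // _; exact: measurable_open_box.
apply/seteqP; split=> [z Az|z [i _]]; last by case: asboolP => // iA /iA.
have [r r0 zA] := HA z Az.
have [n nr] : exists n : nat, 2 * n.+1%:R^-1 <= r.
  exists (Num.bound (2 / r)); rewrite ler_pdivrMr// mulrC -ler_pdivrMr//.
  apply: le_trans (ltW (archi_boundP _)) _; first by rewrite divr_ge0// ltW.
  by rewrite ler_nat.
have n0 : 0 < n.+1%:R^-1 :> R by rewrite invr_gt0.
have rt (x : R) : exists q : rat, `|x - ratr q| < n.+1%:R^-1.
  have : x - n.+1%:R^-1 < x + n.+1%:R^-1 by rewrite ltrBlDr -addrA ltrDl addr_gt0.
  move=> /rat_in_itvoo[q]; rewrite in_itv/= => q12; exists q.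
  by rewrite distrC ltr_distl.
have [q1 h1] := rt z.1.1; have [q2 h2] := rt z.1.2.
have [q3 h3] := rt z.2.1; have [q4 h4] := rt z.2.2.
exists ((q1, q2), (q3, q4), n) => //.
have zb : box ((q1, q2), (q3, q4), n) z by split.
case: asboolP => // -[] w [w1 w2 w3 w4]; apply: zA.
have tri (x y q : R) : `|x - q| < n.+1%:R^-1 -> `|y - q| < n.+1%:R^-1 -> `|y - x| < r.
  move=> xq yq; apply: lt_le_trans nr; rewrite -(subrK q y) -addrA.
  apply: le_lt_trans (ler_normD _ _) _; rewrite mulr_natl mulr2n.
  by rewrite ltrD// distrC.
by split; [exact: tri h1 w1|exact: tri h2 w2|exact: tri h3 w3|exact: tri h4 w4].
Qed.

Lemma measurable_bi_upper : measurable (bi_upper R).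
Proof. by apply: measurableX; exact: measurable_upper. Qed.

Lemma holomorphic_normc_continuous (f : R[i]^o * R[i]^o -> R[i]^o) z :
  holomorphic f -> bi_upper R z -> forall e : R, 0 < e ->
  exists2 r : R, 0 < r & forall w, open_box z r w ->
    `|normc (f (to_complex2 w)) - normc (f (to_complex2 z))| < e.
Proof.
move=> hf /hf /differentiable_continuous/cvgrPdist_lt/= cf e e0.
have e0' : (0 : R[i]) < e%:C%C by rewrite ltcR.
have /nbhs_ballP[/= d d0 Hd] := cf _ e0'.
have [r dE r0] : exists2 r : R, d = r%:C%C & 0 < r.
  exists (complex.Re d); first by rewrite RRe_real// gtr0_real.
  by move: d0; rewrite ltcE => /andP[].
exists (r / 2) => [|w [w1 w2 w3 w4]]; first by rewrite divr_gt0.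
have near (a b c d' : R) : `|c - a| < r / 2 -> `|d' - b| < r / 2 ->
    ball ((a +i* b)%C : R[i]^o) d ((c +i* d')%C : R[i]^o).
  move=> h1 h2; rewrite -ball_normE /ball_/= dE.
  rewrite -[`|_|]/(normc ((a +i* b)%C - (c +i* d')%C))%:C%C ltcR.
  apply: le_lt_trans (ler_normc_abs _ _) _.
  by rewrite (distrC a) (distrC b) (splitr r) ltrD.
rewrite distrC; apply: le_lt_trans (ler_dist_normc _ _) _.
have /Hd : ball (to_complex2 z) d (to_complex2 w).
  by split; apply: near.
by rewrite /= -[`|_|]/(normc (f (to_complex2 z) - f (to_complex2 w)))%:C%C ltcR.
Qed.

(** The superlevel sets are open by continuity. *)
Lemma measurable_normc_holomorphic (f : R[i]^o * R[i]^o -> R[i]^o) :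
  holomorphic f ->
  measurable_fun (bi_upper R) (fun z => normc (f (to_complex2 z))).
Proof.
move=> hf mD; apply: (measurability _ (RGenOInfty.measurableE R)) => //.
move=> _ [_ [a ->] <-]; apply: measurable_of_open_boxes => z [[/= z1 z2]].
rewrite in_itv/= andbT => az.
have e0 : 0 < normc (f (to_complex2 z)) - a by rewrite subr_gt0.
have [r r0 Hr] := holomorphic_normc_continuous hf (conj z1 z2) e0.
exists (Num.min r (Num.min z.1.2 z.2.2)); first by rewrite !lt_min r0 z1 z2.
move=> w [w1 w2 w3 w4]; split.
  split; rewrite /upper/=.
    have : `|w.1.2 - z.1.2| < z.1.2 by apply: lt_le_trans w2 _; rewrite !ge_min lexx orbT.
    by rewrite ltr_norml => /andP[+ _]; rewrite ltrBrDr addNr.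
  have : `|w.2.2 - z.2.2| < z.2.2 by apply: lt_le_trans w4 _; rewrite !ge_min lexx !orbT.
  by rewrite ltr_norml => /andP[+ _]; rewrite ltrBrDr addNr.
rewrite /= in_itv/= andbT.
have /Hr : open_box z r w.
  by split; [apply: lt_le_trans w1 _|apply: lt_le_trans w2 _|
    apply: lt_le_trans w3 _|apply: lt_le_trans w4 _]; rewrite ge_min lexx.
by rewrite ltr_norml => /andP[+ _]; rewrite opprB ltrBrDr subrK.
Qed.

End measurability.

(** * Comparison of measures and of powers *)

Section measure_comparison.
Local Open Scope ereal_scope.
Context d (T : measurableType d) (R : realType).
Variables m1 m2 : {measure set T -> \bar R}.

Lemma le_integral_of_le_measure (S : set T) (k : R) (f : T -> \bar R) :
  measurable S -> (0 <= k)%R ->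
  (forall A, measurable A -> A `<=` S -> m1 A <= k%:E * m2 A) ->
  (forall x, 0 <= f x) -> measurable_fun [set: T] f ->
  \int[m1]_(x in S) f x <= k%:E * \int[m2]_(x in S) f x.
Proof.
move=> mS k0 m12 f0 mf.
rewrite (@eq_measure_integral _ _ _ S (mrestr m1 mS)); last first.
  by move=> A mA AS; rewrite /= /mrestr setIidl.
rewrite -[k%:E]/((NngNum k0)%:num%:E) -ge0_integral_mscale//; last exact: measurable_funTS.
apply: ge0_le_measure_integral => // A mA.
rewrite /= /mrestr /mscale/=; apply: le_trans (m12 _ _ _) _ => //.
  exact: measurableI.
by rewrite lee_wpmul2l// le_measure// ?inE//; exact: measurableI.
Qed.

End measure_comparison.

Section weights.
Context {R : realType}.
Implicit Types (a y v : R).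

Lemma gt0_powRD (x a b : R) : 0 < x -> x `^ (a + b) = x `^ a * x `^ b.
Proof. by move=> x0; rewrite powRD// (gt_eqF x0) implybT. Qed.

Lemma powR2D y a : 0 < y -> y `^ (a + 2) = y ^+ 2 * y `^ a.
Proof. by move=> y0; rewrite gt0_powRD// mulrC powR_mulrn// ltW. Qed.

Lemma powR_exprn (x a : R) k : 0 <= x -> (x ^+ k) `^ a = (x `^ a) ^+ k.
Proof. by move=> x0; rewrite -powR_mulrn// powRAC powR_mulrn// powR_ge0. Qed.

Lemma powR_antitone (e s t : R) : 0 <= e -> 0 < s -> s <= t -> t `^ (- e) <= s `^ (- e).
Proof.
move=> e0 s0 st; have t0 := lt_le_trans s0 st.
rewrite !powRN lef_pV2 ?posrE ?powR_gt0//.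
by apply: ge0_ler_powR; rewrite ?nnegrE ?(ltW s0) ?(ltW t0).
Qed.

(** The constant 2^|a| covers both signs of a. *)
Lemma powR_comparable a y v : 0 < y -> y / 2 <= v <= 2 * y ->
  v `^ a <= 2 `^ `|a| * y `^ a.
Proof.
move=> y0 /andP[yv vy]; have v0 : 0 < v by apply: lt_le_trans yv; rewrite divr_gt0.
have [a0|a0] := leP 0 a.
  rewrite ger0_norm// -powRM ?(ltW y0)//.
  by apply: ge0_ler_powR => //; rewrite nnegrE ?mulr_ge0// ltW.
rewrite ltr0_norm// -[in v `^ a](opprK a) powRN -[in y `^ a](opprK a) (powRN y).
rewrite -[_ `^ _ * _]invf_div lef_pV2 ?posrE ?divr_gt0 ?powR_gt0//.
rewrite ler_pdivrMr ?powR_gt0// mulrC -powRM// ?(ltW v0)//.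
apply: ge0_ler_powR; rewrite ?nnegrE ?mulr_ge0 ?(ltW y0) ?(ltW v0) ?oppr_ge0 ?(ltW a0)//.
by rewrite mulrC -ler_pdivrMr.
Qed.

(** Only x > a matters, and then x = a^(1 - p) (a^(p - 1) x) <= a^(1 - p) x^p. A
    free choice of a lets the first summand be absorbed elsewhere. *)
Lemma le_add_powR (p x a : R) : 1 <= p -> 0 <= x -> 0 < a ->
  x <= a + a `^ (1 - p) * x `^ p.
Proof.
move=> p1 x0 a0; have [xa|ax] := leP x a.
  by rewrite (le_trans xa)// lerDl mulr_ge0 ?powR_ge0.
have xx : x = a `^ (1 - p) * (a `^ (p - 1) * x).
  rewrite mulrA -powRD; last by rewrite (gt_eqF a0) implybT.
  by rewrite addrA subrK subrr powRr0 mul1r.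
rewrite (@le_trans _ _ (a `^ (1 - p) * x `^ p))// ?lerDr ?(ltW a0)//.
rewrite {1}xx ler_wpM2l ?powR_ge0//.
have p0 : 0 < p by exact: lt_le_trans p1.
rewrite -(mulr_powRB1 x0 p0) [leRHS]mulrC ler_wpM2r//.
by apply: ge0_ler_powR; rewrite ?nnegrE ?subr_ge0// ltW.
Qed.

End weights.

Section valpha.
Context {R : realType}.
Variable alpha : R.
Local Notation V := (Valpha alpha).
Local Open Scope ereal_scope.

Lemma Valpha_le (S : set (plane R)) (k : R) : measurable S -> S `<=` upper R ->
  (forall w, S w -> (w.2 `^ alpha <= k)%R) -> V S <= k%:E * lebesgue2 R S.
Proof.
move=> mS SU Sk; rewrite /Valpha setIidl//.
rewrite -integral_cst//; apply: ge0_le_integral => //.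
- by move=> w _; rewrite lee_fin powR_ge0.
- by apply/measurable_EFinP; exact: measurable_density.
Qed.

Lemma Valpha_ge (S : set (plane R)) (k : R) : measurable S -> S `<=` upper R ->
  (0 <= k)%R -> (forall w, S w -> (k <= w.2 `^ alpha)%R) -> k%:E * lebesgue2 R S <= V S.
Proof.
move=> mS SU k0 Sk; rewrite /Valpha setIidl//.
rewrite -integral_cst//; apply: ge0_le_integral => //.
- by apply/measurable_EFinP; exact: measurable_density.
Qed.

End valpha.

(** * Whitney squares and the submean estimate *)

Section whitney.
Context {R : realType}.
Local Notation normc := (@Normc.normc R).

(** Half the side is Im z / 4: heights in the square are within a factor 2 of
    Im z, and a point w of the square is close enough to z for the Carleson
    square over ]Re w - Im w, Re w + Im w[ to contain z. *)
Definition whitney_square (z : plane R) : set (plane R) :=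
  [set w | `|w.1 - z.1| <= z.2 / 4 /\ `|w.2 - z.2| <= z.2 / 4].

Lemma whitney_squareE z : whitney_square z =
  (`[z.1 - z.2 / 4, z.1 + z.2 / 4] `*` `[z.2 - z.2 / 4, z.2 + z.2 / 4])%classic.
Proof.
apply/seteqP; split=> w; rewrite /whitney_square/= !in_itv/= !ler_distl.
  by case.
by case.
Qed.

Lemma measurable_whitney_square z : measurable (whitney_square z).
Proof. by rewrite whitney_squareE; exact: measurableX. Qed.

Lemma whitney_square_height z w : upper R z -> whitney_square z w ->
  z.2 / 2 <= w.2 <= 2 * z.2 /\ w.2 / 2 <= z.2 <= 2 * w.2.
Proof.
rewrite /upper/= => z0 [_]; rewrite ler_distl; lra.
Qed.

Lemma whitney_square_upper z : upper R z -> whitney_square z `<=` upper R.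
Proof.
move=> z0 w /(whitney_square_height z0)[/andP[+ _] _].
by move=> /(lt_le_trans _); apply; rewrite divr_gt0.
Qed.

Lemma lebesgue2_whitney_square z : upper R z ->
  lebesgue2 R (whitney_square z) = (z.2 ^+ 2 / 4)%:E.
Proof.
rewrite /upper/= => z0; rewrite whitney_squareE /lebesgue2 product_measure1E//=.
have z4 : 0 < z.2 / 4 by rewrite divr_gt0.
have lt (c : R) : c - z.2 / 4 < c + z.2 / 4 by rewrite ltrD2l gtrN.
rewrite !lebesgue_measure_itv/= !lte_fin !lt -!EFinB -EFinM; congr EFin.
by field.
Qed.

Lemma Valpha_whitney_square alpha z : upper R z ->
  (Valpha alpha (whitney_square z) <= (2 `^ `|alpha| * z.2 `^ (alpha + 2))%:E)%E.
Proof.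
move=> z0.
apply: le_trans (@Valpha_le _ alpha _ (2 `^ `|alpha| * z.2 `^ alpha) _ _ _) _.
- exact: measurable_whitney_square.
- exact: whitney_square_upper.
- by move=> w /(whitney_square_height z0)[zw _]; exact: powR_comparable.
rewrite lebesgue2_whitney_square// -EFinM lee_fin powR2D// -(mulrA (2 `^ _)) ler_wpM2l ?powR_ge0//.
rewrite mulrC ler_wpM2r ?powR_ge0//.
by rewrite ler_pdivrMr// ler_peMr ?sqr_ge0// ler1n.
Qed.

(** This is [area_mean_estimate] with r = Im z / 4, after Lebesgue measure is
    replaced by the measure V_alpha, comparable to a multiple of it on the
    square. The constant 256 is the product of 16 and of 4^2. *)
Lemma mean_estimate (alpha : R) (h : R[i]^o -> R[i]^o) z :
  (forall w, upper R w -> derivable h (to_complex w) 1) ->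
  measurable_fun (upper R) (fun w => normc (h (to_complex w))) ->
  upper R z ->
  ((z.2 `^ (alpha + 2) * normc (h (to_complex z)))%:E <= (256 * 2 `^ `|alpha|)%:E *
    \int[Valpha alpha]_(w in whitney_square z) (normc (h (to_complex w)))%:E)%E.
Proof.
move=> dh mh z0; have z2 : 0 < z.2 by [].
pose N w := (normc (h (to_complex w)))%:E.
have mW := measurable_whitney_square z; have WU := whitney_square_upper z0.
have mN : measurable_fun (whitney_square z) N.
  by apply/measurable_EFinP; exact: measurable_funS (@measurable_upper R) WU mh.
pose F := N \_ (whitney_square z).
have mF : measurable_fun [set: plane R] F by apply/(measurable_restrictT _ mW).
have F0 w : (0 <= F w)%E.
  by apply: erestrict_ge0 => w' _; rewrite lee_fin normc_ge0.
have IF (m : {measure set (plane R) -> \bar R}) :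
    (\int[m]_w F w = \int[m]_(w in whitney_square z) N w)%E.
  by rewrite [RHS]integral_mkcond.
have hz := @area_mean_estimate _ h z.1 z.2 (z.2 / 4) F.
have {}hz : (((z.2 / 4) ^+ 2 * normc (h (to_complex z)))%:E <=
    16%:E * \int[lebesgue2 R]_(w in whitney_square z) N w)%E.
  rewrite -IF; apply: hz => // [|x y hx hy|x y hx hy].
  - by rewrite divr_gt0.
  - by apply: (dh (x, y)); apply: WU.
  - by rewrite /F patchE mem_set.
pose k := 2 `^ `|alpha| * z.2 `^ (- alpha).
have cmp : (\int[lebesgue2 R]_(w in whitney_square z) N w <=
    k%:E * \int[Valpha alpha]_(w in whitney_square z) N w)%E.
  have FN w : w \in whitney_square z -> N w = F w by move=> wW; rewrite /F patchE wW.
  rewrite (eq_integral F)// [in leRHS](eq_integral F)//.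
  apply: le_integral_of_le_measure => //.
    by rewrite mulr_ge0 ?powR_ge0.
  move=> A mA AW.
  have k0 : 0 < k by rewrite mulr_gt0 ?powR_gt0.
  have := @Valpha_ge _ alpha A k^-1 mA (subset_trans AW WU) _ _.
  rewrite lee_pdivrMl//; apply; first by rewrite invr_ge0 ltW.
  move=> w /AW/(whitney_square_height z0)[_ wz].
  rewrite /k powRN invf_div ler_pdivrMr ?powR_gt0// mulrC.
  apply: powR_comparable => //; move: wz z2; clear; lra.
have c16 : (0 <= 16%:E :> \bar R)%E by rewrite lee_fin.
have := le_trans hz (lee_wpmul2l c16 cmp); rewrite muleA -EFinM.
have Y0 : 0 < 16 * z.2 `^ alpha by rewrite mulr_gt0 ?powR_gt0.
rewrite -(@lee_pmul2l _ (16 * z.2 `^ alpha)%:E)// ?lte_fin// muleA -!EFinM.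
have -> : 16 * z.2 `^ alpha * (16 * k) = 256 * 2 `^ `|alpha|.
  by rewrite /k powRN; field; rewrite gt_eqF ?powR_gt0.
suff -> : 16 * z.2 `^ alpha * ((z.2 / 4) ^+ 2 * normc (h (to_complex z))) =
  z.2 `^ (alpha + 2) * normc (h (to_complex z)) by [].
by rewrite powR2D//; field.
Qed.

(** In [mean_estimate] bound the integrand by |h| <= a + a^(1 - p) |h|^p, with a
    a small multiple of |h(z)|. The constant term then gives at most half of
    the left-hand side and is absorbed by it; dividing by a^(1 - p) gives the
    power p of |h(z)|. *)
Lemma submean_estimate (alpha p : R) : 1 <= p -> exists2 C : R, 0 < C &
  forall (h : R[i]^o -> R[i]^o) z,
  (forall w, upper R w -> derivable h (to_complex w) 1) ->
  measurable_fun (upper R) (fun w => normc (h (to_complex w))) ->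
  upper R z ->
  ((z.2 `^ (alpha + 2) * normc (h (to_complex z)) `^ p)%:E <= C%:E *
    \int[Valpha alpha]_(w in whitney_square z) (normc (h (to_complex w)) `^ p)%:E)%E.
Proof.
move=> p1; have [c1 c1E] : exists c1 : R, c1 = 2 `^ `|alpha| by eexists.
have [c0 c0E] : exists c0 : R, c0 = 256 * c1 by eexists.
have c1_gt0 : 0 < c1 by rewrite c1E powR_gt0.
have c0_gt0 : 0 < c0 by rewrite c0E; apply: mulr_gt0 c1_gt0; rewrite ltr0n.
have c01 : 0 < 2 * c0 * c1 by apply: mulr_gt0 c1_gt0; apply: mulr_gt0 c0_gt0.
exists (2 * c0 * (2 * c0 * c1) `^ (p - 1)) => [|h z dh mh z0].
  by rewrite mulr_gt0 ?powR_gt0// mulr_gt0.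
have z2 : 0 < z.2 by [].
pose N w := normc (h (to_complex w)); have N0 w : 0 <= N w by exact: normc_ge0.
have mW := measurable_whitney_square z; have WU := whitney_square_upper z0.
have mN : measurable_fun (whitney_square z) N.
  by exact: measurable_funS (@measurable_upper R) WU mh.
have mNp : measurable_fun (whitney_square z) (fun w => N w `^ p).
  exact: measurableT_comp (measurable_powR p) mN.
set I := (\int[_]_(_ in _) _)%E.
have I0 : (0 <= I)%E by apply: integral_ge0 => w _; rewrite lee_fin powR_ge0.
have C0 : 0 < 2 * c0 * (2 * c0 * c1) `^ (p - 1) by rewrite mulr_gt0 ?powR_gt0// mulr_gt0.
have [->|n0] := eqVneq (normc (h (to_complex z))) 0.
  rewrite powR0 ?mulr0 ?mule_ge0// ?lee_fin ?(ltW C0)//.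
  by rewrite gt_eqF//; exact: lt_le_trans p1.
have {n0} : 0 < N z by rewrite lt_neqAle eq_sym n0 N0.
rewrite -/(N z) => n0.
have [Ioo|Ifin] := eqVneq I +oo%E.
  by rewrite Ioo gt0_muley ?leey// lte_fin.
have {}Ifin : I \is a fin_num by rewrite ge0_fin_numE// ltey.
have hm := mean_estimate alpha dh mh z0; rewrite -/(N z) -c1E -c0E in hm.
have [Y EY] : exists Y, Y = z.2 `^ (alpha + 2) by eexists.
have Y0 : 0 < Y by rewrite EY powR_gt0.
pose a := N z / (2 * c0 * c1); have a0 : 0 < a by rewrite divr_gt0.
have young : (\int[Valpha alpha]_(w in whitney_square z) (N w)%:E <=
    (a * (c1 * Y))%:E + (a `^ (1 - p))%:E * I)%E.
  apply: (@le_trans _ _ (\int[Valpha alpha]_(w in whitney_square z)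
     (a%:E + (a `^ (1 - p))%:E * (N w `^ p)%:E))%E).
    apply: ge0_le_integral => //.
    - by move=> w _; rewrite lee_fin.
    - exact/measurable_EFinP.
    - apply: emeasurable_funD => //.
      by apply: measurable_funeM; exact/measurable_EFinP.
    - by move=> w _; rewrite -EFinM -EFinD lee_fin le_add_powR.
  rewrite ge0_integralD//; last 3 first.
  - by move=> w _; rewrite lee_fin ltW.
  - by move=> w _; rewrite mule_ge0// lee_fin powR_ge0.
  - by apply: measurable_funeM; exact/measurable_EFinP.
  rewrite integral_cst// ge0_integralZl_EFin ?powR_ge0//; last 2 first.
  - by move=> w _; rewrite lee_fin powR_ge0.
  - exact/measurable_EFinP.
  apply: leeD => //; rewrite (EFinM a); apply: lee_wpmul2l.
    by rewrite lee_fin ltW.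
  by rewrite EY c1E; exact: Valpha_whitney_square.
have c00 : (0 <= c0%:E)%E by rewrite lee_fin ltW.
have := le_trans hm (lee_wpmul2l c00 young).
rewrite -EY -(fineK Ifin); set i := fine I.
rewrite -(EFinM (a `^ (1 - p))) -EFinD -!EFinM !lee_fin.
have -> : c0 * (a * (c1 * Y) + a `^ (1 - p) * i) = Y * N z / 2 + c0 * a `^ (1 - p) * i.
  by rewrite /a; field; rewrite ?gt_eqF.
move=> hY; have {}hY : Y * N z <= 2 * c0 * a `^ (1 - p) * i.
  move: hY; have -> : 2 * c0 * a `^ (1 - p) * i = 2 * (c0 * a `^ (1 - p) * i) by rewrite !mulrA.
  by move: (Y * N z) (c0 * _ * i) => v u; clear; lra.
have aE : a `^ (1 - p) * N z `^ (p - 1) = (2 * c0 * c1) `^ (p - 1).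
  have -> : N z = a * (2 * c0 * c1) by rewrite /a divfK// gt_eqF.
  rewrite (powRM _ (ltW a0) (ltW c01)) mulrA -powRD; last by rewrite (gt_eqF a0) implybT.
  by rewrite addrA subrK subrr powRr0 mul1r.
rewrite -(mulr_powRB1 (ltW n0) (lt_le_trans ltr01 p1)) mulrA.
apply: le_trans (ler_wpM2r (powR_ge0 _ _) hY) _.
by rewrite -aE le_eqVlt; apply/orP; left; apply/eqP; ring.
Qed.

End whitney.

(** * Integration on products *)

Section sigma_finite_tonelli.
Local Open Scope ereal_scope.
Context d1 d2 (T1 : measurableType d1) (T2 : measurableType d2) (R : realType).

(** A copy of the measure m that carries the proof of its sigma-finiteness, so
    that Tonelli's theorem applies to measures which are only known to be
    sigma-finite by a hypothesis. *)
Definition as_sigma_finite d (T : measurableType d)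
  (m : {measure set T -> \bar R}) of sigma_finite setT m : set T -> \bar R := m.

HB.instance Definition _ d (T : measurableType d)
  (m : {measure set T -> \bar R}) (H : sigma_finite setT m) :=
  Measure.on (as_sigma_finite H).

HB.instance Definition _ d (T : measurableType d)
  (m : {measure set T -> \bar R}) (H : sigma_finite setT m) :=
  Measure_isSigmaFinite.Build _ _ _ (as_sigma_finite H) H.

Lemma tonelli (m1 : {measure set T1 -> \bar R}) (m2 : {measure set T2 -> \bar R})
    (f : T1 * T2 -> \bar R) :
  sigma_finite setT m1 -> sigma_finite setT m2 ->
  measurable_fun setT f -> (forall x, 0 <= f x) ->
  [/\ measurable_fun setT (fun x => \int[m2]_y f (x, y)),
      measurable_fun setT (fun y => \int[m1]_x f (x, y)) &
  \int[m1]_x \int[m2]_y f (x, y) = \int[m2]_y \int[m1]_x f (x, y)].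
Proof.
move=> s1 s2 mf f0; split.
- exact: (@measurable_fun_fubini_tonelli_F _ _ _ _ _ (as_sigma_finite s2) f).
- exact: (@measurable_fun_fubini_tonelli_G _ _ _ _ _ (as_sigma_finite s1) f).
- exact: (@fubini_tonelli _ _ _ _ _ (as_sigma_finite s1) (as_sigma_finite s2) f).
Qed.

Lemma sigma_finite_product (m1 : {sigma_finite_measure set T1 -> \bar R})
  (m2 : {sigma_finite_measure set T2 -> \bar R}) : sigma_finite setT (m1 \x m2).
Proof.
exact: isSigmaFinite.sigma_finiteT
  (lebesgue_integral_fubini.measure_function_Measure_isSigmaFinite__to__measure_function_isSigmaFinite m1 m2).
Qed.

Variables (m1 : {sigma_finite_measure set T1 -> \bar R})
          (m2 : {sigma_finite_measure set T2 -> \bar R}).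

Lemma integral_product_set (A : set T1) (B : set T2) (g : T1 * T2 -> \bar R) :
  measurable A -> measurable B -> measurable_fun (A `*` B) g ->
  (forall z, (A `*` B) z -> 0 <= g z) ->
  measurable_fun A (fun x => \int[m2]_(y in B) g (x, y)) /\
  \int[m1 \x m2]_(z in A `*` B) g z =
  \int[m1]_(x in A) \int[m2]_(y in B) g (x, y).
Proof.
move=> mA mB mg g0.
have mAB : measurable (A `*` B) by exact: measurableX.
pose F := g \_ (A `*` B).
have F0 z : 0 <= F z by exact: erestrict_ge0.
have mF : measurable_fun setT F by apply/(measurable_restrictT _ mAB).
have FE : (fun x => \int[m2]_y F (x, y)) = (fun x => \int[m2]_(y in B) g (x, y)) \_ A.
  apply/funext => x; rewrite patchE; case: ifPn => [|] xA.
    rewrite [RHS]integral_mkcond; apply: eq_integral => y _.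
    rewrite /F !patchE; congr (if _ then _ else _).
    by rewrite in_setX xA.
  apply: integral0_eq => y _; rewrite /F patchE in_setX.
  by rewrite (negbTE xA).
have mFF := @measurable_fun_fubini_tonelli_F _ _ _ _ _ m2 F mF F0.
rewrite /fubini_F FE in mFF; split; first by apply/(measurable_restrictT _ mA).
rewrite integral_mkcond (@fubini_tonelli1 _ _ _ _ _ m1 m2 F mF F0) /fubini_F FE.
by rewrite [RHS]integral_mkcond.
Qed.

Lemma integral_product_mul (A : set T1) (B : set T2) (g1 : T1 -> \bar R)
    (g2 : T2 -> \bar R) : measurable A -> measurable B ->
  measurable_fun A g1 -> measurable_fun B g2 ->
  (forall x, 0 <= g1 x) -> (forall y, 0 <= g2 y) ->
  \int[m1 \x m2]_(z in A `*` B) (g1 z.1 * g2 z.2) =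
  (\int[m1]_(x in A) g1 x) * (\int[m2]_(y in B) g2 y).
Proof.
move=> mA mB mg1 mg2 g10 g20.
have mg : measurable_fun (A `*` B) (fun z => g1 z.1 * g2 z.2).
  apply: emeasurable_funM.
    apply: (@measurable_comp _ _ _ _ _ _ A g1 _ fst) => //.
      by move=> _ [z [? ?] <-].
    exact: measurable_funTS.
  apply: (@measurable_comp _ _ _ _ _ _ B g2 _ snd) => //.
    by move=> _ [z [? ?] <-].
  exact: measurable_funTS.
have [_ ->] := integral_product_set mA mB mg
  (fun z _ => mule_ge0 (g10 z.1) (g20 z.2)).
have I0 : 0 <= \int[m2]_(y in B) g2 y by exact: integral_ge0.
rewrite -ge0_integralZr//; apply: eq_integral => x _ /=.
by rewrite ge0_integralZl.
Qed.

End sigma_finite_tonelli.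

(** * Domination by a geometric series *)

Section dyadic.
Local Open Scope ereal_scope.
Context d (T : measurableType d) (R : realType).
Variable m : {measure set T -> \bar R}.

(** The sets E k may overlap: g is at most the sum of the functions b k on E k,
    which is integrated term by term. *)
Lemma integral_le_geometric (D : set T) (E : nat -> set T) (g : T -> \bar R)
    (b : nat -> R) (M r : R) :
  measurable D -> measurable_fun D g -> (forall x, D x -> 0 <= g x) ->
  (forall k, measurable (E k)) -> (forall k, (0 <= b k)%R) -> (0 <= r < 1)%R ->
  (forall x, D x -> exists2 k, E k x & g x <= (b k)%:E) ->
  (forall k, (b k)%:E * m (E k) <= (M * r ^+ k)%:E) ->
  \int[m]_(x in D) g x <= (M / (1 - r))%:E.
Proof.
move=> mD mg g0 mE b0 /andP[r0 r1] Hg HE.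
pose u k x := (b k * \1_(E k) x)%R%:E.
have u0 k x : 0 <= u k x by rewrite lee_fin mulr_ge0.
have mu k : measurable_fun D (u k).
  by apply/measurable_EFinP; apply: measurable_funM.
apply: (@le_trans _ _ (\int[m]_(x in D) (\sum_(k <oo) u k x))).
  apply: ge0_le_integral => //.
  - by apply: ge0_emeasurable_sum.
  - move=> x /Hg[k Ekx gx]; apply: le_trans gx _.
    apply: (@le_trans _ _ (\sum_(0 <= i < k.+1) u i x)); last first.
      exact: (nneseries_lim_ge k.+1 (P := predT)).
    rewrite big_nat_recr//= {2}/u indicE mem_set// mulr1.
    by rewrite leeDr// sume_ge0.
rewrite integral_nneseries//.
apply: (@le_trans _ _ (\sum_(k <oo) (M * r ^+ k)%:E)).
  apply: lee_nneseries => [k _ _|k _]; first exact: integral_ge0.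
  apply: le_trans (HE k).
  rewrite /u; under eq_integral do rewrite EFinM.
  rewrite ge0_integralZl_EFin//; last first.
    by apply/measurable_EFinP; apply: measurable_funTS; exact: measurable_indic.
  rewrite integral_indic// lee_wpmul2l ?lee_fin// le_measure ?inE//.
  exact: measurableI.
rewrite le_eqVlt; apply/orP; left; apply/eqP.
apply/cvg_lim => //.
have := @cvg_geometric_series R M r; rewrite ger0_norm// => /(_ r1) h.
rewrite (_ : (fun n => _) = EFin \o series (geometric M r)).
  by apply: cvg_EFin => //; near=> n.
apply/funext => n; rewrite /series/= -sumEFin.
by rewrite big_mkord.
Unshelve. all: by end_near. Qed.

End dyadic.

(** * The measure of Carleson squares *)

Section carleson_squares.
Context {R : realType}.

Lemma dyadic_scale (y l : R) : 0 < y -> y <= l ->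
  exists k, (l * 2^-1 ^+ k) / 2 <= y <= l * 2^-1 ^+ k.
Proof.
move=> y0 yl; have l0 := lt_le_trans y0 yl.
have ex : exists k, l * 2^-1 ^+ k.+1 <= y.
  exists (Num.bound (l / y)); rewrite exprVn ler_pdivrMr ?exprn_gt0//.
  rewrite mulrC -ler_pdivrMr//; apply: le_trans (ltW (archi_boundP _)) _.
    by rewrite divr_ge0// ltW.
  by rewrite -natrX ler_nat ltnW// (leq_trans (ltn_expl _ (leqnn 2)))// leq_exp2l.
case: (ex_minnP ex) => k ky min; exists k.
rewrite -mulrA -exprSr ky/=; case: k ky min => [|k] ky min.
  by rewrite expr0 mulr1.
by rewrite leNgt; apply/negP => /ltW /min; rewrite ltnn.
Qed.

Lemma carleson_squareE (I : interval R) (l : R) :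
  lebesgue_measure [set` I] = l%:E ->
  carleson_square I = ([set` I] `*` `]0, l[)%classic.
Proof.
move=> Il; apply/seteqP; split => z; rewrite /carleson_square Il.
  by case=> zI z0; rewrite lte_fin => zl; split => //=; rewrite in_itv/= z0.
by case=> zI /=; rewrite in_itv/= -lte_fin => /andP[z0 zl].
Qed.

Lemma carleson_square_upper (I : interval R) : carleson_square I `<=` upper R.
Proof. by move=> z []. Qed.

Lemma measurable_carleson_square (I : interval R) : measurable (carleson_square I).
Proof.
rewrite (_ : carleson_square I = ([set` I] `*` setT) `&` upper R `&`
   [set z : plane R | (z.2%:E < lebesgue_measure [set` I])%E]).
  apply: measurableI.
    by apply: measurableI; [exact: measurableX|exact: measurable_upper].
  rewrite -[X in measurable X]setTI; apply: measurable_lte => //.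
  by apply/measurable_EFinP; exact: measurable_snd.
by apply/seteqP; split=> z; rewrite /carleson_square/=; [case|case=> -[[]]].
Qed.

Lemma lebesgue2_strip (I : interval R) (l s t : R) (b1 b2 : bool) : s <= t ->
  lebesgue_measure [set` I] = l%:E ->
  lebesgue2 R ([set` I] `*` [set` Interval (BSide b1 s) (BSide b2 t)]) = (l * (t - s))%:E.
Proof.
move=> st Il; transitivity (lebesgue_measure [set` I] *
    lebesgue_measure [set` Interval (BSide b1 s) (BSide b2 t)])%E.
  exact: product_measure1E.
rewrite Il lebesgue_measure_itv/= lte_fin; case: ltP => ts; first by rewrite -EFinB -EFinM.
by rewrite (@le_anti _ _ s t) ?st// subrr mulr0 mule0.
Qed.

(** At heights between l / 2^(k + 1) and l / 2^k the density is comparable to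
    (l / 2^k)^alpha. These layers have measures that form a geometric series of
    ratio 2^(- (alpha + 1)), which is less than 1 as alpha > -1. *)
Lemma Valpha_carleson_square_le (alpha : R) : -1 < alpha ->
  exists2 c : R, 0 < c & forall (I : interval R) (l : R), 0 < l ->
  lebesgue_measure [set` I] = l%:E ->
  (Valpha alpha (carleson_square I) <= (c * l `^ (alpha + 2))%:E)%E.
Proof.
move=> alpha1; have a1 : 0 < alpha + 1 by rewrite -ltrBlDr sub0r.
pose r : R := 2^-1 `^ (alpha + 1).
have r01 : 0 <= r < 1.
  rewrite powR_ge0/= /r; have := @gt0_ltr_powR R _ a1 2^-1 1; rewrite powR1.
  by apply; rewrite ?nnegrE ?invr_ge0// invf_lt1// ltr1n.
have r1 : 0 < 1 - r by rewrite subr_gt0; case/andP: r01.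
exists (2 `^ `|alpha| / (1 - r)) => [|I l l0 Il]; first by rewrite divr_gt0// powR_gt0.
have mQ := measurable_carleson_square I.
rewrite /Valpha setIidl; last exact: carleson_square_upper.
have h2 : 0 <= 2^-1 :> R by rewrite invr_ge0.
have h20 k : 0 < 2^-1 ^+ k :> R by rewrite exprn_gt0// invr_gt0.
rewrite mulrAC.
apply: (@integral_le_geometric _ (plane R) R (lebesgue2 R) _
  (fun k => ([set` I] `*` `]0%R, (l * 2^-1 ^+ k)%R])%classic : set (plane R))
  _ (fun k => 2 `^ `|alpha| * (l * 2^-1 ^+ k) `^ alpha)) => //.
- by apply/measurable_EFinP; exact: measurable_density.
- by move=> z _; rewrite lee_fin powR_ge0.
- by move=> k; exact: measurableX.
- by move=> k; rewrite mulr_ge0// powR_ge0.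
- move=> z; rewrite (carleson_squareE Il) => -[/= zI]; rewrite in_itv/= => /andP[z0 zl].
  have [k /andP[k1 k2]] := dyadic_scale z0 (ltW zl).
  exists k; first by split => //=; rewrite in_itv/= z0.
  rewrite lee_fin; apply: powR_comparable; first by rewrite mulr_gt0.
  by rewrite k1 (le_trans k2)// ler_peMl ?mulr_ge0 ?(ltW l0) ?(ltW (h20 k))// ler1n.
- move=> k; have lk : 0 <= l * 2^-1 ^+ k by rewrite mulr_ge0 ?(ltW l0) ?(ltW (h20 k)).
  rewrite [X in (_ * X)%E](lebesgue2_strip _ _ lk Il).
  rewrite -EFinM lee_fin subr0.
  rewrite powRM ?(ltW l0) ?(ltW (h20 k))// powR_exprn//.
  rewrite powR2D// /r powRD; last by rewrite (gt_eqF a1).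
  rewrite powRr1// exprMn -!mulrA le_eqVlt; apply/orP; left; apply/eqP; congr (_ * _).
  by move: (_ `^ _ ^+ k) (2^-1 ^+ k) (l `^ _) => u v w; ring.
Qed.

(** The upper half of the square suffices. *)
Lemma Valpha_carleson_square_ge (alpha : R) (I : interval R) (l : R) : 0 < l ->
  lebesgue_measure [set` I] = l%:E ->
  (((2 `^ `|alpha|)^-1 / 2 * l `^ (alpha + 2))%:E <= Valpha alpha (carleson_square I))%E.
Proof.
move=> l0 Il; have mQ := measurable_carleson_square I.
have l2 : l / 2 <= l by rewrite ler_pdivrMr// ler_peMr ?(ltW l0)// ler1n.
pose S := ([set` I] `*` `]l / 2, l[)%classic.
have SQ : S `<=` carleson_square I.
  rewrite (carleson_squareE Il) => z [zI]; rewrite /= in_itv/= => /andP[z1 z2].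
  by split => //=; rewrite in_itv/= z2 (lt_trans _ z1)// divr_gt0.
have mS : measurable S by exact: measurableX.
apply: (@le_trans _ _ (Valpha alpha S)); last by apply: le_measure; rewrite ?inE.
apply: le_trans (@Valpha_ge _ alpha S ((2 `^ `|alpha|)^-1 * l `^ alpha) _ _ _ _).
- rewrite [X in (_ * X)%E](lebesgue2_strip _ _ l2 Il) -EFinM lee_fin powR2D// le_eqVlt.
  by apply/orP; left; apply/eqP; field; rewrite gt_eqF// powR_gt0.
- exact: mS.
- by move=> z /SQ; exact: carleson_square_upper.
- by rewrite mulr_ge0 ?invr_ge0 ?powR_ge0.
- move=> z [_ /=]; rewrite in_itv/= => /andP[z1 z2].
  have z0 : 0 < z.2 by rewrite (lt_trans _ z1)// divr_gt0.
  rewrite mulrC ler_pdivrMr ?powR_gt0// mulrC; apply: powR_comparable => //.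
  by move: z1 z2 l0 z0; clear; lra.
Qed.

Lemma lebesgue_measure_centered (u v : R) : 0 < v ->
  lebesgue_measure [set` `]u - v, u + v[] = (2 * v)%:E :> \bar R.
Proof.
move=> v0; rewrite lebesgue_measure_itv/= lte_fin ltrD2l gtrN// -EFinB.
by congr EFin; ring.
Qed.

Lemma Vbi_carleson_box (a1 a2 : R) (I1 I2 : interval R) :
  Vbi a1 a2 (carleson_box I1 I2) =
  (Valpha a1 (carleson_square I1) * Valpha a2 (carleson_square I2))%E.
Proof.
by rewrite /Vbi /carleson_box product_measure1E//; exact: measurable_carleson_square.
Qed.

End carleson_squares.

(** * The submean estimate in two variables *)

Section two_variables.
Context {R : realType}.
Local Notation normc := (@Normc.normc R).
Local Notation biplane := (plane R * plane R)%type.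
Implicit Types f : R[i]^o * R[i]^o -> R[i]^o.

Lemma derivable_slice1 f (c1 c2 : R[i]^o) : differentiable f (c1, c2) ->
  derivable (fun z => f (z, c2)) c1 1.
Proof.
move=> df; have := @diff_derivable _ _ _ f (c1, c2) (1, 0) df.
rewrite /derivable (_ : (fun h => _) = fun h : R[i] => h^-1 *:
  (((fun z => f (z, c2)) \o shift c1) (h *: (1 : R[i]^o)) - f (c1, c2)))//.
apply/funext => h; congr (_ *: (f _ - _)); rewrite /shift/=.
by congr (_, _); rewrite /= scaler0 add0r.
Qed.

Lemma derivable_slice2 f (c1 c2 : R[i]^o) : differentiable f (c1, c2) ->
  derivable (fun z => f (c1, z)) c2 1.
Proof.
move=> df; have := @diff_derivable _ _ _ f (c1, c2) (0, 1) df.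
rewrite /derivable (_ : (fun h => _) = fun h : R[i] => h^-1 *:
  (((fun z => f (c1, z)) \o shift c2) (h *: (1 : R[i]^o)) - f (c1, c2)))//.
apply/funext => h; congr (_ *: (f _ - _)); rewrite /shift/=.
by congr (_, _); rewrite /= scaler0 add0r.
Qed.

Definition whitney_box (z : biplane) : set biplane :=
  whitney_square z.1 `*` whitney_square z.2.

Lemma measurable_whitney_box z : measurable (whitney_box z).
Proof. by apply: measurableX; exact: measurable_whitney_square. Qed.

Lemma whitney_box_bi_upper z : bi_upper R z -> whitney_box z `<=` bi_upper R.
Proof.
move=> [z1 z2] w [w1 w2]; split.
  exact: whitney_square_upper w1.
exact: whitney_square_upper w2.
Qed.

(** Comparable to the measure of the Whitney box of z and to that of a Carleson
    box with sides comparable to the heights of z. *)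
Definition box_weight (a1 a2 : R) (z : biplane) : R :=
  z.1.2 `^ (a1 + 2) * z.2.2 `^ (a2 + 2).

Lemma measurable_normc_powR f (p : R) (D : set biplane) : holomorphic f ->
  measurable D -> D `<=` bi_upper R ->
  measurable_fun D (fun w => (normc (f (to_complex2 w)) `^ p)%:E).
Proof.
move=> hf mD DU; apply/measurable_EFinP.
apply: (measurableT_comp (measurable_powR p)).
exact: measurable_funS (@measurable_bi_upper R) DU (measurable_normc_holomorphic hf).
Qed.

(** First the estimate in the first variable, at the second coordinate of z, then
    the estimate in the second variable under the integral. *)
Lemma submean_estimate2 (a1 a2 p : R) : 1 <= p -> exists2 C : R, 0 < C &
  forall f z, holomorphic f -> bi_upper R z ->
  ((box_weight a1 a2 z * normc (f (to_complex2 z)) `^ p)%:E <= C%:E *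
    \int[Vbi a1 a2]_(w in whitney_box z) (normc (f (to_complex2 w)) `^ p)%:E)%E.
Proof.
move=> p1; have [C1 C10 H1] := submean_estimate a1 p1.
have [C2 C20 H2] := submean_estimate a2 p1.
exists (C1 * C2) => [|f z hf [z1 z2]]; first exact: mulr_gt0.
pose G (w : biplane) := (normc (f (to_complex2 w)) `^ p)%:E.
have G0 w : (0 <= G w)%E by rewrite lee_fin powR_ge0.
have mW1 := measurable_whitney_square z.1; have mW2 := measurable_whitney_square z.2.
have WU1 := whitney_square_upper z1; have WU2 := whitney_square_upper z2.
have mN := measurable_normc_holomorphic hf.
have mU := @measurable_upper R.
have m1 : measurable_fun (upper R)
    (fun w => normc (f (to_complex2 (w, z.2)))).
  apply: (@measurable_comp _ _ _ _ _ _ (bi_upper R)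
    (fun w : biplane => normc (f (to_complex2 w))) (upper R) (fun w => (w, z.2))) => //.
  - exact: measurable_bi_upper.
  - by move=> _ [w wU <-].
  - by apply: measurable_funTS; exact: pair2_measurable.
have m2 w1 : upper R w1 -> measurable_fun (upper R)
    (fun w => normc (f (to_complex2 (w1, w)))).
  move=> w1U; apply: (@measurable_comp _ _ _ _ _ _ (bi_upper R)
    (fun w : biplane => normc (f (to_complex2 w))) (upper R) (fun w => (w1, w))) => //.
  - exact: measurable_bi_upper.
  - by move=> _ [w wU <-].
  - by apply: measurable_funTS; exact: pair1_measurable.
have d1 w : upper R w -> derivable (fun c => f (c, to_complex z.2)) (to_complex w) 1.
  by move=> wU; apply: derivable_slice1; exact: (hf (w, z.2)).
have d2 w1 w : upper R w1 -> upper R w ->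
    derivable (fun c => f (to_complex w1, c)) (to_complex w) 1.
  by move=> w1U wU; apply: derivable_slice2; exact: (hf (w1, w)).
have [mI E] := @integral_product_set _ _ _ _ R (Valpha a1) (Valpha a2) _ _ G mW1 mW2
  (measurable_normc_powR p hf (measurable_whitney_box z) (whitney_box_bi_upper (conj z1 z2)))
  (fun w _ => G0 w).
rewrite [in leRHS]/Vbi [X in (_ <= _ * X)%E]E.
have step1 := H1 _ z.1 d1 m1 z1.
have y2 : 0 < z.2.2 `^ (a2 + 2) by rewrite powR_gt0.
have step2 w1 : whitney_square z.1 w1 ->
    ((z.2.2 `^ (a2 + 2))%:E * G (w1, z.2) <=
     C2%:E * \int[Valpha a2]_(w in whitney_square z.2) G (w1, w))%E.
  by move=> /WU1 w1U; rewrite -EFinM; exact: H2 _ z.2 (fun w => d2 w1 w w1U) (m2 w1 w1U) z2.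
rewrite /box_weight [X in X * _]mulrC -mulrA EFinM.
apply: (@le_trans _ _ ((z.2.2 `^ (a2 + 2))%:E * (C1%:E *
   \int[Valpha a1]_(w in whitney_square z.1) G (w, z.2)))%E).
  by apply: lee_wpmul2l; rewrite ?lee_fin ?(ltW y2)//; exact: step1.
rewrite muleCA [(C1 * C2)%:E]EFinM -muleA lee_wpmul2l ?lee_fin ?(ltW C10)//.
have mG1 : measurable_fun (whitney_square z.1) (fun w => G (w, z.2)).
  apply/measurable_EFinP; apply: (measurableT_comp (measurable_powR p)).
  exact: measurable_funS mU WU1 m1.
have I0 w : (0 <= \int[Valpha a2]_(y in whitney_square z.2) G (w, y))%E.
  by apply: integral_ge0.
rewrite -ge0_integralZl_EFin//; last exact: ltW.
rewrite -ge0_integralZl_EFin//; last exact: ltW.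
apply: ge0_le_integral => //.
- by move=> w _; rewrite mule_ge0// lee_fin ltW.
- exact: measurable_funeM.
- exact: measurable_funeM.
Qed.

End two_variables.

(** * Sufficiency of the Carleson condition *)

Section embedding.
Context {R : realType}.
Local Notation normc := (@Normc.normc R).
Local Notation biplane := (plane R * plane R)%type.
Implicit Types f : R[i]^o * R[i]^o -> R[i]^o.

Definition tent_base (w : plane R) : interval R := `]w.1 - w.2, w.1 + w.2[.

Definition tent_box (w : biplane) : set biplane :=
  carleson_box (tent_base w.1) (tent_base w.2).

Lemma tent_base_measure w : upper R w ->
  lebesgue_measure [set` tent_base w] = (2 * w.2)%:E :> \bar R.
Proof. exact: lebesgue_measure_centered. Qed.

Lemma measurable_tent_box w : bi_upper R w -> measurable (tent_box w).
Proof.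
move=> [w1 w2]; apply: measurableX.
  exact: measurable_carleson_square.
exact: measurable_carleson_square.
Qed.

(** Here |Re z - Re w| <= Im z / 4 < Im w, and Im z <= (4 / 3) Im w < 2 Im w. *)
Lemma tent_of_whitney z w : upper R z -> whitney_square z w ->
  carleson_square (tent_base w) z.
Proof.
rewrite /upper/= => z0 zw; have w0 := whitney_square_upper z0 zw.
case: zw; rewrite !ler_norml => h1 h2.
split => //; first by rewrite /tent_base in_itv/=; move: h1 h2 z0; clear; lra.
by rewrite tent_base_measure// lte_fin; move: h1 h2 z0; clear; lra.
Qed.

Lemma tent_box_of_whitney z w : bi_upper R z -> whitney_box z w -> tent_box w z.
Proof. by move=> [z1 z2] [w1 w2]; split; exact: tent_of_whitney. Qed.

Lemma box_weight_gt0 (a1 a2 : R) z : bi_upper R z -> 0 < box_weight a1 a2 z.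
Proof. by move=> [z1 z2]; rewrite mulr_gt0 ?powR_gt0. Qed.

Lemma carleson_tent_box (a1 a2 s : R) (mu : {measure set biplane -> \bar R}) :
  -1 < a1 -> -1 < a2 -> 0 <= s -> carleson_measure s a1 a2 mu ->
  exists2 C : R, 0 < C & forall w, bi_upper R w ->
  (mu (tent_box w) <= (C * box_weight a1 a2 w `^ s)%:E)%E.
Proof.
move=> ha1 ha2 s0 [C [C0 HC]].
have [c1 c10 H1] := Valpha_carleson_square_le ha1.
have [c2 c20 H2] := Valpha_carleson_square_le ha2.
pose k : R := (c1 * 2 `^ (a1 + 2)) * (c2 * 2 `^ (a2 + 2)).
have k0 : 0 < k by rewrite !mulr_gt0 ?powR_gt0.
exists (C * k `^ s) => [|w [w1 w2]]; first by rewrite mulr_gt0 ?powR_gt0.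
have l1 := tent_base_measure w1; have l2 := tent_base_measure w2.
apply: le_trans (HC _ _) _; rewrite Vbi_carleson_box.
have w10 : 0 < 2 * w.1.2 by rewrite mulr_gt0.
have w20 : 0 < 2 * w.2.2 by rewrite mulr_gt0.
have h1 := H1 _ _ w10 l1; have h2 := H2 _ _ w20 l2.
have kE : c1 * (2 * w.1.2) `^ (a1 + 2) * (c2 * (2 * w.2.2) `^ (a2 + 2)) =
    k * box_weight a1 a2 w.
  rewrite !powRM ?(ltW w1) ?(ltW w2)// /k /box_weight.
  by ring.
have V12 : (Valpha a1 (carleson_square (tent_base w.1)) *
    Valpha a2 (carleson_square (tent_base w.2)) <= (k * box_weight a1 a2 w)%:E)%E.
  by rewrite -kE EFinM; apply: lee_pmul.
rewrite -mulrA EFinM lee_wpmul2l ?lee_fin ?(ltW C0)//.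
rewrite -powRM ?(ltW k0)//; last exact/ltW/box_weight_gt0.
rewrite -poweR_EFin; apply: gt0_ler_poweR => //.
- by rewrite in_itv/= leey andbT mule_ge0.
- by rewrite in_itv/= leey andbT lee_fin mulr_ge0 ?(ltW k0)// ltW// box_weight_gt0.
Qed.

(** The boxes over (i (n + 1), i (n + 1)) exhaust the product of half-planes.
    This is what makes Tonelli's theorem available for an arbitrary mu that
    satisfies a Carleson condition. *)
Lemma sigma_finite_restriction (mu : {measure set biplane -> \bar R}) :
  (forall w, bi_upper R w -> (mu (tent_box w) < +oo)%E) ->
  sigma_finite setT (mrestr mu (@measurable_bi_upper R)).
Proof.
move=> muQ; pose c n : plane R := (0, n.+1%:R).
have cU n : bi_upper R (c n, c n) by split; rewrite /upper/= ltr0n.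
exists (fun n => ~` bi_upper R `|` tent_box (c n, c n)).
- apply/seteqP; split => // z _.
  have [Uz|Uz] := pselect (bi_upper R z); last by exists 0%N => //; left.
  pose m := Num.bound (`|z.1.1| + `|z.1.2| + `|z.2.1| + `|z.2.2|).
  exists m => //; right.
  have hm : `|z.1.1| + `|z.1.2| + `|z.2.1| + `|z.2.2| < m.+1%:R.
    apply: lt_trans (archi_boundP _) _; first by rewrite !addr_ge0.
    by rewrite ltr_nat.
  have sq (x : plane R) : upper R x -> `|x.1| < m.+1%:R -> `|x.2| < m.+1%:R ->
      carleson_square (tent_base (c m)) x.
    move=> x0 x1 x2; split => //.
      by rewrite /tent_base in_itv/= sub0r add0r -ltr_norml.
    rewrite tent_base_measure; last by rewrite /upper/= ltr0n.
    rewrite lte_fin/=; apply: le_lt_trans (ler_norm _) (lt_le_trans x2 _).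
    by rewrite ler_peMl// ler1n.
  case: Uz => z1 z2.
  have := normr_ge0 z.1.1; have := normr_ge0 z.1.2.
  have := normr_ge0 z.2.1; have := normr_ge0 z.2.2.
  by split; apply: sq => //; lra.
- move=> n; have mt := measurable_tent_box (cU n).
  have mU := @measurable_bi_upper R.
  split; first by apply: measurableU => //; exact: measurableC.
  rewrite /mrestr setIUl setICl set0U; apply: le_lt_trans (muQ _ (cU n)).
  by apply: le_measure; rewrite ?inE//; exact: measurableI.
Qed.

Lemma measurable_set_le d (T : measurableType d) (f g : T -> R) :
  measurable_fun [set: T] f -> measurable_fun [set: T] g ->
  measurable [set x | f x <= g x].
Proof.
move=> mf mg; rewrite -[X in measurable X]setTI.
rewrite (_ : [set x | _] = [set x | ((f x)%:E <= (g x)%:E)%E]); last first.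
  by apply/seteqP; split=> x /=; rewrite lee_fin.
by apply: measurable_lee => //; exact/measurable_EFinP.
Qed.

Definition whitney_graph : set (biplane * biplane) :=
  [set zw | bi_upper R zw.1 /\ whitney_box zw.1 zw.2].

Lemma measurable_whitney_graph : measurable whitney_graph.
Proof.
have mc : forall (u v h : biplane * biplane -> R),
    measurable_fun setT u -> measurable_fun setT v -> measurable_fun setT h ->
    measurable [set x | `|u x - v x| <= h x / 4].
  move=> u v h mu mv mh; apply: measurable_set_le.
    by apply: measurableT_comp => //; exact: measurable_funB.
  exact: measurable_funM.
rewrite (_ : whitney_graph = (bi_upper R `*` setT) `&`
  ([set x | `|x.2.1.1 - x.1.1.1| <= x.1.1.2 / 4] `&`
   [set x | `|x.2.1.2 - x.1.1.2| <= x.1.1.2 / 4] `&`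
   ([set x | `|x.2.2.1 - x.1.2.1| <= x.1.2.2 / 4] `&`
   [set x | `|x.2.2.2 - x.1.2.2| <= x.1.2.2 / 4]))); last first.
  apply/seteqP; split => x.
    by move=> [xU [[h1 h2] [h3 h4]]]; split.
  by move=> [[xU _] [[h1 h2] [h3 h4]]]; split => //; split.
apply: measurableI; first by apply: measurableX => //; exact: measurable_bi_upper.
have m1 : measurable_fun setT (fun x : biplane * biplane => x.1) by exact: measurable_fst.
have m2 : measurable_fun setT (fun x : biplane * biplane => x.2) by exact: measurable_snd.
have mc1 : forall (u : biplane * biplane -> plane R), measurable_fun setT u ->
    measurable_fun setT (fun x => (u x).1 : R).
  by move=> u mu; exact: measurableT_comp measurable_fst mu.
have mc2 : forall (u : biplane * biplane -> plane R), measurable_fun setT u ->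
    measurable_fun setT (fun x => (u x).2 : R).
  by move=> u mu; exact: measurableT_comp measurable_snd mu.
have m11 := measurableT_comp measurable_fst m1.
have m12 := measurableT_comp measurable_snd m1.
have m21 := measurableT_comp measurable_fst m2.
have m22 := measurableT_comp measurable_snd m2.
by apply: measurableI; apply: measurableI; apply: mc;
  first [exact: mc1 | exact: mc2].
Qed.

Lemma box_weight_comparable (a1 a2 s : R) z w : bi_upper R z -> whitney_box z w ->
  box_weight a1 a2 z `^ (- s) <=
  2 `^ `|- ((a1 + 2) * s)| * 2 `^ `|- ((a2 + 2) * s)| * box_weight a1 a2 w `^ (- s).
Proof.
move=> [z1 z2] [w1 w2].
have u1 := whitney_square_upper z1 w1; have u2 := whitney_square_upper z2 w2.
have [_ h1] := whitney_square_height z1 w1; have [_ h2] := whitney_square_height z2 w2.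
rewrite /box_weight !powRM ?powR_ge0// -!powRrM !mulrN.
rewrite mulrACA; apply: ler_pM; rewrite ?powR_ge0//; exact: powR_comparable.
Qed.

(** The pointwise bound by an average over a Whitney box is integrated against
    mu. After an exchange of integrals the inner one is, up to weights, at most
    a multiple of the mu-measure of the set of z whose Whitney box contains w,
    which lies in [tent_box w]. *)
Lemma carleson_embedding (a1 a2 p q : R) (mu : {measure set biplane -> \bar R}) :
  -1 < a1 -> -1 < a2 -> 1 < p -> p <= q -> carleson_measure (q / p) a1 a2 mu ->
  exists C : R, 0 < C /\ forall f, bergman p a1 a2 f ->
  (integral_abs_powR mu q f <=
   C%:E * integral_abs_powR (Vbi a1 a2) p f `^ (q / p))%E.
Proof.
move=> ha1 ha2 p1 pq hmu.
have p0 : 0 < p by rewrite (lt_trans _ p1).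
have [s sE] : exists s : R, s = q / p by eexists.
have qE : q = p * s by rewrite sE mulrC divfK// gt_eqF.
have s1 : 1 <= s by rewrite sE ler_pdivlMr// mul1r.
have s0 : 0 < s by rewrite (lt_le_trans _ s1).
rewrite -sE in hmu *.
have [C C0 HC] := carleson_tent_box ha1 ha2 (ltW s0) hmu.
have [C1 C10 H1] := submean_estimate2 a1 a2 (ltW p1).
pose k : R := 2 `^ `|- ((a1 + 2) * s)| * 2 `^ `|- ((a2 + 2) * s)|.
have k0 : 0 < k by rewrite mulr_gt0 ?powR_gt0.
exists (C1 `^ s * (k * C)); split => [|f [hf fint]].
  by rewrite !mulr_gt0 ?powR_gt0.
pose N z := normc (f (to_complex2 z)); have N0 z : 0 <= N z by exact: normc_ge0.
pose G (z : biplane) := (N z `^ p)%:E.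
have G0 z : (0 <= G z)%E by rewrite lee_fin powR_ge0.
have mU := @measurable_bi_upper R.
pose W := box_weight a1 a2.
pose B := integral_abs_powR (Vbi a1 a2) p f.
have BE : B = (\int[Vbi a1 a2]_(z in bi_upper R) G z)%E by [].
have B0 : (0 <= B)%E by rewrite BE; apply: integral_ge0.
have [b bE] : exists b : R, B = b%:E.
  by exists (fine B); rewrite fineK// ge0_fin_numE.
have b0 : 0 <= b by rewrite -lee_fin -bE.
have mG : measurable_fun (bi_upper R) G by exact: measurable_normc_powR.
(* of the s factors N z ^ p, one is bounded by the average over the Whitney box
   and s - 1 >= 0 by the whole norm *)
have pointwise z : bi_upper R z -> ((N z `^ q)%:E <= (C1 `^ s * b `^ (s - 1))%:E *
    ((W z `^ (- s))%:E * \int[Vbi a1 a2]_(w in whitney_box z) G w))%E.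
  move=> Uz; have Wz : 0 < W z by exact: box_weight_gt0.
  have hz := H1 f z hf Uz; rewrite -/(N z) -/(W z) in hz.
  set J := (\int[_]_(_ in whitney_box z) _)%E in hz *.
  have J0 : (0 <= J)%E by apply: integral_ge0 => w _; exact: G0.
  have JB : (J <= B)%E.
    rewrite BE; apply: ge0_subset_integral => //.
    - exact: measurable_whitney_box.
    - by move=> w _; exact: G0.
    - exact: whitney_box_bi_upper.
  have [j jE] : exists j : R, J = j%:E.
    by exists (fine J); rewrite fineK// ge0_fin_numE// (le_lt_trans JB)// bE ltry.
  rewrite jE bE lee_fin in JB; rewrite jE lee_fin in J0.
  rewrite jE -EFinM lee_fin in hz.
  rewrite jE -!EFinM lee_fin qE powRrM.
  set n := N z `^ p in hz *; have n0 : 0 <= n by rewrite powR_ge0.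
  have Wn0 : 0 <= W z * n by rewrite mulr_ge0// ltW.
  have e1 : (W z * n) `^ s <= C1 `^ s * b `^ (s - 1) * j.
    rewrite -(mulr_powRB1 Wn0 s0).
    apply: (@le_trans _ _ (C1 * j * (C1 * b) `^ (s - 1))).
      apply: ler_pM => //; first exact: powR_ge0.
      apply: ge0_ler_powR; rewrite ?nnegrE ?subr_ge0//.
        by rewrite mulr_ge0// ltW.
      by apply: le_trans hz _; rewrite ler_wpM2l// ltW.
    rewrite powRM ?(ltW C10)// -(mulr_powRB1 (ltW C10) s0).
    by rewrite le_eqVlt; apply/orP; left; apply/eqP; ring.
  rewrite powRM ?(ltW Wz)// in e1.
  rewrite powRN mulrCA ler_pdivlMl ?powR_gt0//.
(* integrated over w, H gives the right-hand side of the pointwise bound;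
   integrated over z, it is controlled by the Carleson condition *)
pose H : biplane * biplane -> \bar R :=
  (fun zw => (W zw.1 `^ (- s))%:E * G zw.2)%E \_ whitney_graph.
have mA := measurable_whitney_graph.
have H0 zw : (0 <= H zw)%E.
  by apply: erestrict_ge0 => x _; rewrite mule_ge0// lee_fin powR_ge0.
have mH : measurable_fun setT H.
  apply/(measurable_restrictT _ mA); apply: emeasurable_funM.
    apply/measurable_EFinP; apply: measurable_funTS.
    apply: (measurableT_comp (measurable_powR (- s))).
    apply: measurable_funM; apply: (measurableT_comp (measurable_powR _)).
      exact: measurableT_comp measurable_snd (measurableT_comp measurable_fst measurable_fst).
    exact: measurableT_comp measurable_snd (measurableT_comp measurable_snd measurable_fst).
  apply: (@measurable_comp _ _ _ _ _ _ (bi_upper R) G _ (fun zw => zw.2)) => //.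
    by move=> _ [zw [Uz zw12] <-]; exact: whitney_box_bi_upper zw12.
  by apply: measurable_funTS; exact: measurable_snd.
have inner z : bi_upper R z -> (\int[Vbi a1 a2]_w H (z, w) =
    (W z `^ (- s))%:E * \int[Vbi a1 a2]_(w in whitney_box z) G w)%E.
  move=> Uz; have mz := measurable_whitney_box z.
  rewrite -ge0_integralZl_EFin ?powR_ge0//; last first.
    exact: measurable_funS mU (whitney_box_bi_upper Uz) mG.
  rewrite [RHS]integral_mkcond; apply: eq_integral => w _.
  rewrite /H !patchE; congr (if _ then _ else _).
  apply/idP/idP => [/set_mem[_ zw]|/set_mem zw]; first exact: mem_set.
  by apply: mem_set; split.
have sf1 : sigma_finite setT (mrestr mu mU).
  by apply: sigma_finite_restriction => w /HC /le_lt_trans; apply; rewrite ltry.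
have sf2 : sigma_finite setT (Vbi a1 a2) by exact: sigma_finite_product.
have [mF mF' tonelliE] := tonelli sf1 sf2 mH H0.
set F := (fun z => _) in mF.
have F0 z : (0 <= F z)%E by apply: integral_ge0.
have K10 : 0 <= C1 `^ s * b `^ (s - 1) by rewrite mulr_ge0 ?powR_ge0.
have step1 : (integral_abs_powR mu q f <=
    (C1 `^ s * b `^ (s - 1))%:E * \int[mrestr mu mU]_z F z)%E.
  apply: (@le_trans _ _ (\int[mu]_(z in bi_upper R)
      ((C1 `^ s * b `^ (s - 1))%:E * F z))%E).
    apply: ge0_le_integral => //.
    - by move=> z _; rewrite lee_fin powR_ge0.
    - exact: measurable_normc_powR.
    - by apply: measurable_funeM; exact: measurable_funTS.
    - by move=> z Uz; rewrite /F inner//; exact: pointwise.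
  rewrite ge0_integralZl_EFin//; last exact: measurable_funTS.
  rewrite lee_wpmul2l ?lee_fin//.
  rewrite (@eq_measure_integral _ _ _ _ (mrestr mu mU)); last first.
    by move=> A mA' AU; rewrite /= /mrestr setIidl.
  by apply: ge0_subset_integral.
have step2 w : (\int[mrestr mu mU]_z H (z, w) <= (k * C)%:E * (G \_ (bi_upper R)) w)%E.
  rewrite [in leRHS]patchE; case: ifPn => [|] Uw; last first.
    rewrite mule0 integral0_eq// => z _; rewrite /H patchE ifF//.
    apply/negbTE; apply: contra Uw; rewrite !inE => -[/= Uz zw].
    exact: whitney_box_bi_upper zw.
  rewrite inE in Uw; have Ww : 0 < W w by exact: box_weight_gt0.
  pose c := k * W w `^ (- s) * N w `^ p.
  have c0 : 0 <= c by rewrite !mulr_ge0 ?powR_ge0// ltW.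
  have mt := measurable_tent_box Uw.
  apply: (@le_trans _ _ (\int[mrestr mu mU]_(z in tent_box w) (cst c%:E z))%E).
    rewrite [leRHS]integral_mkcond; apply: ge0_le_integral => //.
    - exact: measurableT_comp mH (pair2_measurable w).
    - by apply/(measurable_restrictT _ mt); exact: measurable_cst.
    - move=> z _; rewrite /H !patchE; case: ifPn => [|_].
        rewrite inE => -[/= Uz zw]; rewrite ifT; last first.
          by rewrite inE; exact: tent_box_of_whitney.
        rewrite /G -EFinM lee_fin /c ler_wpM2r ?powR_ge0//.
        exact: box_weight_comparable.
      by case: ifPn => _; rewrite lee_fin.
  rewrite integral_cst// /mrestr.
  apply: (@le_trans _ _ (c%:E * (C * W w `^ s)%:E)%E).
    rewrite lee_wpmul2l ?lee_fin//; apply: le_trans (HC w Uw).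
    by apply: le_measure; rewrite ?inE//; exact: measurableI.
  rewrite /G -!EFinM lee_fin /c powRN le_eqVlt; apply/orP; left; apply/eqP.
  by field; rewrite gt_eqF// powR_gt0.
have step3 : (\int[mrestr mu mU]_z F z <= (k * C * b)%:E)%E.
  rewrite /F tonelliE (EFinM (k * C)) -bE BE [X in (_ * X)%E]integral_mkcond.
  have mGU : measurable_fun setT (G \_ (bi_upper R)) by apply/(measurable_restrictT _ mU).
  rewrite -ge0_integralZl_EFin//; last 2 first.
  - by move=> w _; exact: erestrict_ge0.
  - by rewrite mulr_ge0// ltW.
  apply: ge0_le_integral => //.
  - by move=> w _; apply: integral_ge0.
  - exact: measurable_funeM.
apply: le_trans step1 _.
apply: (@le_trans _ _ ((C1 `^ s * b `^ (s - 1))%:E * (k * C * b)%:E)%E).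
  by rewrite lee_wpmul2l ?lee_fin.
rewrite -/B bE poweR_EFin -!EFinM lee_fin -(mulr_powRB1 b0 s0).
by rewrite le_eqVlt; apply/orP; left; apply/eqP; ring.
Qed.

End embedding.

(** * Test functions with poles outside the half-plane *)

Section test_functions.
Context {R : realType}.
Local Notation normc := (@Normc.normc R).
Local Notation biplane := (plane R * plane R)%type.
Local Notation cplx x y := ((x +i* y)%C : R[i]^o).

Definition pole_kernel (n : nat) (u l : R) : R[i]^o -> R[i]^o :=
  fun c => (c - cplx u (- l))^-1 ^+ n.

Definition test_function (n : nat) (u1 l1 u2 l2 : R) :
    R[i]^o * R[i]^o -> R[i]^o :=
  fun c => pole_kernel n u1 l1 c.1 * pole_kernel n u2 l2 c.2.

Lemma differentiable_pole_kernel n (u l : R) (z : plane R) : 0 < l -> upper R z ->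
  differentiable (pole_kernel n u l) (to_complex z).
Proof.
move=> l0 z0.
have dc : derivable (fun _ : R[i]^o => cplx u (- l)) (to_complex z) 1 by exact: derivable_cst.
have dden := derivableB (@derivable_id _ _ (to_complex z) 1) dc.
have n0 : (id - (fun=> cplx u (- l))) (to_complex z) != 0 :> R[i].
  apply/eqP => e0; have /subr0_eq : (z.1 +i* z.2)%C - (u +i* - l)%C = 0 :> R[i] := e0.
  by case=> _ e2; move: z0; rewrite /upper/= e2 oppr_gt0 ltNge (ltW l0).
have /derivable1_diffP := @derivableX _ _ _ n _ _ (derivableV n0 dden).
by rewrite exprfctE.
Qed.

Lemma differentiable_fst_snd (c : R[i]^o * R[i]^o) :
  differentiable (fst : R[i]^o * R[i]^o -> R[i]^o) c /\
  differentiable (snd : R[i]^o * R[i]^o -> R[i]^o) c.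
Proof.
split.
  by apply: (@linear_differentiable _ _ _ fst) => x; exact: cvg_fst.
by apply: (@linear_differentiable _ _ _ snd) => x; exact: cvg_snd.
Qed.

Lemma holomorphic_test_function n (u1 l1 u2 l2 : R) : 0 < l1 -> 0 < l2 ->
  holomorphic (test_function n u1 l1 u2 l2).
Proof.
move=> l10 l20 z [z1 z2].
have [d1 d2] := differentiable_fst_snd (to_complex2 z).
have D1 := differentiable_comp d1 (@differentiable_pole_kernel n u1 l1 z.1 l10 z1).
have D2 := differentiable_comp d2 (@differentiable_pole_kernel n u2 l2 z.2 l20 z2).
exact: (differentiableM D1 D2).
Qed.

Definition pole_dist (u l : R) (z : plane R) : R := normc (cplx (z.1 - u) (z.2 + l)).

Lemma normc_pole_kernel n u l z :
  normc (pole_kernel n u l (to_complex z)) = (pole_dist u l z)^-1 ^+ n.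
Proof.
have E : to_complex z - cplx u (- l) = cplx (z.1 - u) (z.2 + l).
  by apply/eqP; rewrite eq_complex/= opprK !eqxx.
by rewrite /pole_kernel E normcX Normc.normcV.
Qed.

Lemma pole_dist_ge (u l : R) (z : plane R) : 0 < l -> upper R z ->
  `|z.1 - u| <= pole_dist u l z /\ z.2 + l <= pole_dist u l z.
Proof.
move=> l0 z0; split; first exact: (ler_Re_normc (cplx (z.1 - u) (z.2 + l))).
by apply: le_trans (ler_norm _) _; exact: (ler_Im_normc (cplx (z.1 - u) (z.2 + l))).
Qed.

Lemma pole_dist_gt0 (u l : R) (z : plane R) : 0 < l -> upper R z -> 0 < pole_dist u l z.
Proof.
by move=> l0 z0; apply: lt_le_trans (pole_dist_ge u l0 z0).2; rewrite addr_gt0.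
Qed.

Lemma pole_dist_le (u l : R) (z : plane R) : 0 < l -> upper R z ->
  pole_dist u l z <= `|z.1 - u| + (z.2 + l).
Proof.
move=> l0 z0; apply: le_trans (ler_normc_abs _ _) _.
by rewrite (@ger0_norm _ (z.2 + l))// ltW// addr_gt0.
Qed.

Lemma normc_pole_kernel_powR n (p u l : R) z : 0 < l -> upper R z ->
  normc (pole_kernel n u l (to_complex z)) `^ p = pole_dist u l z `^ (- (n%:R * p)).
Proof.
move=> l0 z0; have D0 := pole_dist_gt0 u l0 z0.
by rewrite normc_pole_kernel exprVn -powR_invn ?(ltW D0)// -powRrM mulNr.
Qed.

(** The Carleson squares over ]u - 2^k l, u + 2^k l[ cover the half-plane, and a
    point that is not in the (k - 1)-st one is at distance at least 2^(k - 1) l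
    of the pole u - i l. The resulting series is geometric of ratio
    2^(alpha + 2 - n p), less than 1 as n p > alpha + 2. *)
Lemma integral_pole_kernel_le (alpha p : R) n : -1 < alpha -> 0 <= p ->
  alpha + 2 < n%:R * p -> exists2 K : R, 0 < K & forall u l : R, 0 < l ->
  measurable_fun (upper R) (fun z => (normc (pole_kernel n u l (to_complex z)) `^ p)%:E) ->
  (\int[Valpha alpha]_(z in upper R)
     (normc (pole_kernel n u l (to_complex z)) `^ p)%:E
   <= (K * l `^ (alpha + 2 - n%:R * p))%:E)%E.
Proof.
move=> ha p0 hn; have [c c0 Hc] := Valpha_carleson_square_le ha.
have [e eE] : exists e : R, e = n%:R * p by eexists.
rewrite -eE in hn *; have e0 : 0 <= e by rewrite eE mulr_ge0.
pose r : R := 2 `^ (alpha + 2 - e).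
have r01 : 0 <= r < 1.
  rewrite powR_ge0/= /r -opprB powRN invf_lt1 ?powR_gt0//.
  have := @gt0_ltr_powR R (e - (alpha + 2)) _ 1 2; rewrite powR1; apply.
  - by rewrite subr_gt0.
  - by rewrite nnegrE.
  - by rewrite nnegrE.
  - by rewrite ltr1n.
have r1 : 0 < 1 - r by rewrite subr_gt0; case/andP: r01.
pose h : R := 2^-1 `^ (- e).
have h0 : 0 < h by rewrite powR_gt0// invr_gt0.
exists (c * h * 2 `^ (alpha + 2) / (1 - r)) => [|u l l0 mg].
  by rewrite divr_gt0// !mulr_gt0// powR_gt0.
have p2 k : 0 < 2 ^+ k * l by rewrite mulr_gt0// exprn_gt0.
pose I k : interval R := `]u - 2 ^+ k * l, u + 2 ^+ k * l[.
have mI k := lebesgue_measure_centered u (p2 k).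
rewrite mulrAC.
apply: (@integral_le_geometric _ (plane R) R (Valpha alpha) _
  (fun k => carleson_square (I k)) _ (fun k => (2 ^+ k * l / 2) `^ (- e))) => //.
- exact: measurable_upper.
- by move=> z _; rewrite lee_fin powR_ge0.
- by move=> k; exact: measurable_carleson_square.
- by move=> k; exact: powR_ge0.
- move=> z z0; have z20 : 0 < z.2 by [].
  have ex : exists k, (`|z.1 - u| < 2 ^+ k * l) && (z.2 < 2 * (2 ^+ k * l)).
    pose t := `|z.1 - u| + z.2; have t0 : 0 < t by rewrite ltr_wpDl.
    have ht : t < 2 ^+ Num.bound (t / l) * l.
      rewrite -ltr_pdivrMr//; apply: lt_le_trans (archi_boundP _) _.
        by rewrite divr_ge0// ltW.
      by rewrite -natrX ler_nat ltnW// ltn_expl.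
    exists (Num.bound (t / l)); apply/andP; split.
      by apply: le_lt_trans ht; rewrite lerDl ltW.
    apply: (@le_lt_trans _ _ t); first by rewrite lerDr.
    by apply: lt_le_trans ht _; rewrite ler_peMl ?(ltW (p2 _))// ler1n.
  case: (ex_minnP ex) => k /andP[k1 k2] min; exists k.
    split => //; first by rewrite /I in_itv/= -ltr_distl.
    by rewrite (mI k) lte_fin.
  rewrite lee_fin normc_pole_kernel_powR// -eE.
  have [D1 D2] := pole_dist_ge u l0 z0.
  apply: powR_antitone => //; first by rewrite divr_gt0.
  case: k k1 k2 min => [|k] k1 k2 min.
    rewrite expr0 mul1r (le_trans _ D2)// ler_pdivrMr//.
    by move: l0 z20; clear; lra.
  have -> : 2 ^+ k.+1 * l / 2 = 2 ^+ k * l by rewrite exprS; field.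
  have := min k; have [h1|h1] := ltP `|z.1 - u| (2 ^+ k * l); last first.
    by move=> _; rewrite (le_trans h1).
  have [h2|h2] := ltP z.2 (2 * (2 ^+ k * l)); first by move=> /(_ isT); rewrite ltnn.
  move=> _; apply: le_trans D2; apply: (@le_trans _ _ (2 * (2 ^+ k * l))).
    by rewrite ler_peMl ?(ltW (p2 k))// ler1n.
  by rewrite (le_trans h2)// lerDl ltW.
- move=> k; have mul20 : 0 < 2 * (2 ^+ k * l) by rewrite mulr_gt0.
  apply: le_trans (lee_wpmul2l _ (Hc _ _ mul20 (mI k))) _.
    by rewrite lee_fin powR_ge0.
  have k20 : 0 <= 2 ^+ k :> R by rewrite exprn_ge0.
  have i2 : 0 <= 2^-1 :> R by rewrite invr_ge0.
  rewrite -EFinM lee_fin.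
  rewrite (powRM _ (ltW (p2 k)) i2) (powRM _ k20 (ltW l0)) -/h.
  rewrite (powRM _ (ler0n _ 2) (ltW (p2 k))) (powRM _ k20 (ltW l0)).
  have rE : r ^+ k = (2 `^ (alpha + 2)) ^+ k * (2 `^ (- e)) ^+ k.
    by rewrite /r gt0_powRD// exprMn.
  rewrite !powR_exprn// rE (gt0_powRD (alpha + 2) (- e) l0).
  rewrite le_eqVlt; apply/orP; left; apply/eqP.
  by move: (_ ^+ k) (_ ^+ k) => v w; ring.
Qed.

End test_functions.

(** * Necessity of the Carleson condition *)

Section necessity.
Context {R : realType}.
Local Notation normc := (@Normc.normc R).
Local Notation biplane := (plane R * plane R)%type.

Lemma ler_dist_interval (I : interval R) (l x y : R) :
  lebesgue_measure [set` I] = l%:E -> x \in I -> y \in I -> `|x - y| <= l.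
Proof.
move=> Il; wlog xy : x y / x <= y => [hw xI yI|].
  have [xy|/ltW yx] := leP x y; first exact: hw.
  by rewrite distrC; exact: hw.
move=> xI yI; rewrite distrC ger0_norm ?subr_ge0//.
have xyI : [set` `[x, y]] `<=` [set` I].
  move=> t /=; rewrite in_itv/= => /andP[xt ty].
  by apply: (interval_is_interval xI yI); rewrite xt.
rewrite -lee_fin -Il; apply: (@le_trans _ _ (lebesgue_measure [set` `[x, y]])).
  rewrite lebesgue_measure_itv/= lte_fin; case: ltP => yx; first by rewrite EFinB.
  by rewrite lee_fin subr_le0.
by apply: le_measure; rewrite ?inE.
Qed.

Lemma interval_nonempty (I : interval R) (l : R) : 0 < l ->
  lebesgue_measure [set` I] = l%:E -> exists x, x \in I.
Proof.
move=> l0 Il; apply/not_existsP => nI.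
suff I0 : [set` I] = set0 by move: Il l0; rewrite I0 measure0 => -[<-]; rewrite ltxx.
by apply/seteqP; split => x //= xI; exact: nI xI.
Qed.

Lemma carleson_square_measure0 (I : interval R) :
  lebesgue_measure [set` I] = 0%E -> carleson_square I = set0.
Proof.
move=> I0; apply/seteqP; split=> z //=; rewrite /carleson_square I0 => -[_ z0].
by rewrite lte_fin => /(lt_trans z0); rewrite ltxx.
Qed.

Lemma Valpha_carleson_square_infty (alpha : R) (I : interval R) :
  lebesgue_measure [set` I] = +oo%E -> Valpha alpha (carleson_square I) = +oo%E.
Proof.
move=> Ioo; pose S := ([set` I] `*` `]1%R, 2%R[)%classic : set (plane R).
have mS : measurable S by exact: measurableX.
have SQ : S `<=` carleson_square I.
  move=> z [zI]; rewrite /= in_itv/= => /andP[z1 z2].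
  by split => //; [exact: lt_trans z1|rewrite Ioo ltry].
apply/eqP; rewrite -leye_eq.
apply: (@le_trans _ _ (Valpha alpha S)); last first.
  by apply: le_measure; rewrite ?inE//; exact: measurable_carleson_square.
have leb : lebesgue2 R S = +oo%E.
  transitivity (lebesgue_measure [set` I] * lebesgue_measure [set` `]1%R, 2%R[])%E.
    exact: product_measure1E.
  rewrite Ioo lebesgue_measure_itv/= lte_fin ltr1n/= -EFinB gt0_mulye// lte_fin.
have k0 : 0 < (2 `^ `|alpha|)^-1 :> R by rewrite invr_gt0 powR_gt0.
have := @Valpha_ge _ alpha S (2 `^ `|alpha|)^-1 mS _ (ltW k0) _.
rewrite [X in (_ * X)%E]leb gt0_muley ?lte_fin//; apply.
  by move=> z /SQ [].
move=> z [_]; rewrite /= in_itv/= => /andP[z1 z2].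
have z0 : 0 < z.2 by rewrite (lt_trans _ z1).
rewrite -[leLHS]mul1r ler_pdivrMr ?powR_gt0//.
rewrite [leRHS]mulrC; have := @powR_comparable _ alpha z.2 1 z0; rewrite powR1; apply.
by move: z1 z2; clear; lra.
Qed.

(** If one of the intervals has length 0, the Carleson box is empty; otherwise,
    if one of them is unbounded, the right-hand side is infinite. *)
Lemma carleson_inequality_or_bounded_sides (s C a1 a2 : R) (mu : {measure set biplane -> \bar R})
  (I1 I2 : interval R) : 0 < s -> 0 < C ->
  (mu (carleson_box I1 I2) <= C%:E * Vbi a1 a2 (carleson_box I1 I2) `^ s)%E \/
  exists l1 l2 : R, [/\ 0 < l1, 0 < l2, lebesgue_measure [set` I1] = l1%:E &
    lebesgue_measure [set` I2] = l2%:E].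
Proof.
move=> s0 C0.
have VE := Vbi_carleson_box a1 a2 I1 I2.
have rhs0 : (0 <= C%:E * Vbi a1 a2 (carleson_box I1 I2) `^ s)%E.
  by rewrite mule_ge0 ?poweR_ge0// lee_fin ltW.
have mu00 : carleson_square I1 = set0 \/ carleson_square I2 = set0 ->
    (mu (carleson_box I1 I2) <= C%:E * Vbi a1 a2 (carleson_box I1 I2) `^ s)%E.
  move=> Q0; suff b0 : carleson_box I1 I2 = set0 by rewrite {1}b0 measure0.
  by rewrite /carleson_box; case: Q0 => ->; rewrite ?set0X ?setX0.
have rhsoo : Vbi a1 a2 (carleson_box I1 I2) = +oo%E ->
    (mu (carleson_box I1 I2) <= C%:E * Vbi a1 a2 (carleson_box I1 I2) `^ s)%E.
  by move=> ->; rewrite poweRyr ?gt_eqF// gt0_muley ?leey// lte_fin.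
have Vpos (a : R) (I : interval R) (l : R) : 0 < l -> lebesgue_measure [set` I] = l%:E ->
    (0 < Valpha a (carleson_square I))%E.
  move=> l0 Il; apply: lt_le_trans (Valpha_carleson_square_ge a l0 Il).
  by rewrite lte_fin mulr_gt0 ?powR_gt0// divr_gt0// invr_gt0 powR_gt0.
have cases (I : interval R) : [\/ lebesgue_measure [set` I] = 0%E,
    lebesgue_measure [set` I] = +oo%E |
    exists2 l : R, 0 < l & lebesgue_measure [set` I] = l%:E].
  have : (0 <= lebesgue_measure [set` I])%E by exact: measure_ge0.
  case: (lebesgue_measure [set` I]) => [l| |//]; last by constructor 2.
  rewrite lee_fin le_eqVlt => /predU1P[<-|l0]; first by constructor 1.
  by constructor 3; exists l.
case: (cases I1) => [/carleson_square_measure0 ?|I1oo|[l1 l10 I1l]].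
- by left; apply: mu00; left.
- case: (cases I2) => [/carleson_square_measure0 ?|I2oo|[l2 l20 I2l]].
  + by left; apply: mu00; right.
  + left; apply: rhsoo; rewrite VE (Valpha_carleson_square_infty a1 I1oo).
    by rewrite (Valpha_carleson_square_infty a2 I2oo) mulyy.
  + left; apply: rhsoo; rewrite VE (Valpha_carleson_square_infty a1 I1oo).
    by rewrite gt0_mulye// (Vpos _ _ l2).
- case: (cases I2) => [/carleson_square_measure0 ?|I2oo|[l2 l20 I2l]].
  + by left; apply: mu00; right.
  + left; apply: rhsoo; rewrite VE (Valpha_carleson_square_infty a2 I2oo).
    by rewrite gt0_muley// (Vpos _ _ l1).
  + by right; exists l1, l2.
Qed.

(** A function of one variable is seen as a holomorphic function of two
    variables, and restricted to the diagonal. *)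
Lemma measurable_pole_kernel n (p u l : R) : 0 < l ->
  measurable_fun (upper R)
    (fun z => (normc (pole_kernel n u l (to_complex z)) `^ p)%:E).
Proof.
move=> l0; pose F : R[i]^o * R[i]^o -> R[i]^o := pole_kernel n u l \o fst.
have hF : holomorphic F.
  move=> z [z1 z2]; have [d1 _] := differentiable_fst_snd (to_complex2 z).
  exact: differentiable_comp d1 (@differentiable_pole_kernel _ n u l z.1 l0 z1).
apply: (@measurable_comp _ _ _ _ _ _ (bi_upper R)
  (fun w : biplane => (normc (F (to_complex2 w)) `^ p)%:E) (upper R) (fun w => (w, w))).
- exact: measurable_bi_upper.
- by move=> _ [w wU <-].
- exact: measurable_normc_powR hF (@measurable_bi_upper R) (@subset_refl _ _).
- by apply: measurable_funTS; apply: measurable_fun_pair.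
Qed.

Lemma integral_test_function_le (a1 a2 p : R) n : -1 < a1 -> -1 < a2 -> 0 <= p ->
  a1 + 2 < n%:R * p -> a2 + 2 < n%:R * p ->
  exists2 K : R, 0 < K & forall u1 l1 u2 l2 : R, 0 < l1 -> 0 < l2 ->
  (integral_abs_powR (Vbi a1 a2) p (test_function n u1 l1 u2 l2) <=
   (K * (l1 `^ (a1 + 2 - n%:R * p) * l2 `^ (a2 + 2 - n%:R * p)))%:E)%E.
Proof.
move=> ha1 ha2 p0 hn1 hn2.
have [K1 K10 HK1] := integral_pole_kernel_le ha1 p0 hn1.
have [K2 K20 HK2] := integral_pole_kernel_le ha2 p0 hn2.
exists (K1 * K2) => [|u1 l1 u2 l2 l10 l20]; first exact: mulr_gt0.
pose G (n : nat) (u l : R) z := (normc (pole_kernel n u l (to_complex z)) `^ p)%:E.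
have mG u l : 0 < l -> measurable_fun (upper R) (G n u l).
  exact: measurable_pole_kernel.
have G0 u l z : (0 <= G n u l z)%E by rewrite lee_fin powR_ge0.
have mU := @measurable_upper R.
have -> : integral_abs_powR (Vbi a1 a2) p (test_function n u1 l1 u2 l2) =
   ((\int[Valpha a1]_(z in upper R) G n u1 l1 z) *
    (\int[Valpha a2]_(z in upper R) G n u2 l2 z))%E.
  rewrite -(integral_product_mul (Valpha a1) (Valpha a2) mU mU
    (mG u1 l1 l10) (mG u2 l2 l20) (G0 u1 l1) (G0 u2 l2)).
  apply: eq_integral => z _.
  by rewrite -EFinM Normc.normcM powRM ?normc_ge0.
rewrite mulrACA EFinM; apply: lee_pmul.
- by apply: integral_ge0 => z _; exact: G0.
- by apply: integral_ge0 => z _; exact: G0.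
- by apply: HK1 => //; exact: mG.
- by apply: HK2 => //; exact: mG.
Qed.

Lemma pole_kernel_ge n (q : R) (I : interval R) (u l : R) z : 0 <= q -> 0 < l ->
  lebesgue_measure [set` I] = l%:E -> u \in I -> carleson_square I z ->
  (3 * l) `^ (- (n%:R * q)) <= normc (pole_kernel n u l (to_complex z)) `^ q.
Proof.
move=> q0 l0 Il uI [zI z0]; rewrite Il lte_fin => zl.
rewrite normc_pole_kernel_powR//; apply: powR_antitone; first exact: mulr_ge0.
  exact: pole_dist_gt0.
apply: le_trans (pole_dist_le u l0 z0) _.
by have := ler_dist_interval Il zI uI; move: zl; clear; lra.
Qed.

Lemma test_function_carleson_box_le n (q : R) (I1 I2 : interval R) (u1 l1 u2 l2 : R)
    (mu : {measure set biplane -> \bar R}) : 0 <= q -> 0 < l1 -> 0 < l2 ->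
  lebesgue_measure [set` I1] = l1%:E -> lebesgue_measure [set` I2] = l2%:E ->
  u1 \in I1 -> u2 \in I2 ->
  (((3 * l1) `^ (- (n%:R * q)) * (3 * l2) `^ (- (n%:R * q)))%:E *
     mu (carleson_box I1 I2) <=
   integral_abs_powR mu q (test_function n u1 l1 u2 l2))%E.
Proof.
move=> q0 l10 l20 Il1 Il2 uI1 uI2.
have hf := @holomorphic_test_function _ n u1 l1 u2 l2 l10 l20.
have mQ : measurable (carleson_box I1 I2).
  by apply: measurableX; exact: measurable_carleson_square.
have QU : carleson_box I1 I2 `<=` bi_upper R by move=> z [[_ ? _] [_ ? _]].
set m := _ * _; have m0 : 0 <= m by rewrite mulr_ge0 ?powR_ge0.
rewrite -integral_cst//; apply: (@le_trans _ _
  (\int[mu]_(w in carleson_box I1 I2)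
     (normc (test_function n u1 l1 u2 l2 (to_complex2 w)) `^ q)%:E)%E).
  apply: ge0_le_integral => //.
  - exact: measurable_normc_powR.
  - move=> w [w1 w2]; rewrite lee_fin Normc.normcM powRM ?normc_ge0//.
    apply: ler_pM; rewrite ?powR_ge0//.
      exact: pole_kernel_ge q0 l10 Il1 uI1 w1.
    exact: pole_kernel_ge q0 l20 Il2 uI2 w2.
apply: ge0_subset_integral => //.
- exact: measurable_bi_upper.
- exact: measurable_normc_powR hf (@measurable_bi_upper R) (@subset_refl _ _).
- by move=> w _; rewrite lee_fin powR_ge0.
Qed.

(** The test function with poles at u_j - i l_j, l_j = |I_j|, is bounded below on
    the Carleson box by a multiple of (l1 l2)^(-n), and the p-th power of its
    norm is at most a multiple of the product of the l_j^(a_j + 2 - n p).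
    Raising the latter to the power s = q / p produces (l1 l2)^(-n q), which
    cancels against the lower bound. *)
Lemma carleson_necessary (a1 a2 p q : R) (mu : {measure set biplane -> \bar R}) :
  -1 < a1 -> -1 < a2 -> 1 < p -> p <= q ->
  (exists C : R, 0 < C /\ forall f, bergman p a1 a2 f ->
    (integral_abs_powR mu q f <=
     C%:E * integral_abs_powR (Vbi a1 a2) p f `^ (q / p))%E) ->
  carleson_measure (q / p) a1 a2 mu.
Proof.
move=> ha1 ha2 p1 pq [C [C0 HC]].
have p0 : 0 < p by rewrite (lt_trans _ p1).
have q0 : 0 < q by rewrite (lt_le_trans p0).
have [s sE] : exists s : R, s = q / p by eexists.
have qE : q = p * s by rewrite sE mulrC divfK// gt_eqF.
have s0 : 0 < s by rewrite sE divr_gt0.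
rewrite -sE in HC *.
(* n is large enough for the test functions to have finite norm *)
have [n hn1 hn2] : exists2 n, a1 + 2 < n%:R * p & a2 + 2 < n%:R * p.
  pose n := Num.bound (`|a1| + `|a2| + 2).
  have hn (a : R) : `|a| <= `|a1| + `|a2| -> a + 2 < n%:R * p.
    move=> ha; apply: (@lt_le_trans _ _ n%:R); last by rewrite ler_peMr// ltW.
    apply: le_lt_trans (archi_boundP _); last by rewrite addr_ge0// addr_ge0.
    by rewrite lerD2r (le_trans (ler_norm _)).
  by exists n; apply: hn; rewrite ?lerDl ?lerDr.
have [K K0 HK] := integral_test_function_le ha1 ha2 (ltW p0) hn1 hn2.
have [c1 c1E] : exists c : R, c = (2 `^ `|a1|)^-1 / 2 by eexists.
have [c2 c2E] : exists c : R, c = (2 `^ `|a2|)^-1 / 2 by eexists.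
have c10 : 0 < c1 by rewrite c1E divr_gt0// invr_gt0 powR_gt0.
have c20 : 0 < c2 by rewrite c2E divr_gt0// invr_gt0 powR_gt0.
have [e eE] : exists e : R, e = n%:R * q by eexists.
have [C' C'E] : exists C' : R, C' = C * K `^ s * (3 `^ e * 3 `^ e) / (c1 * c2) `^ s.
  by eexists.
have C'0 : 0 < C'.
  by rewrite C'E; apply: divr_gt0; rewrite ?powR_gt0 ?mulr_gt0 ?powR_gt0.
exists C'; split => // I1 I2.
have [//|[l1 [l2 [l10 l20 Il1 Il2]]]] := carleson_inequality_or_bounded_sides a1 a2 mu I1 I2 s0 C'0.
have [u1 uI1] := interval_nonempty l10 Il1; have [u2 uI2] := interval_nonempty l20 Il2.
have hf := @holomorphic_test_function _ n u1 l1 u2 l2 l10 l20.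
have norm_le := HK u1 l1 u2 l2 l10 l20.
have fB : bergman p a1 a2 (test_function n u1 l1 u2 l2).
  by split => //; apply: le_lt_trans norm_le _; rewrite ltry.
have lower := test_function_carleson_box_le n mu (ltW q0) l10 l20 Il1 Il2 uI1 uI2.
have [m mE] : exists m : R, m = (3 * l1) `^ (- e) * (3 * l2) `^ (- e) by eexists.
have [X XE] : exists X : R,
    X = K * (l1 `^ (a1 + 2 - n%:R * p) * l2 `^ (a2 + 2 - n%:R * p)) by eexists.
have [Y YE] : exists Y : R, Y = c1 * l1 `^ (a1 + 2) * (c2 * l2 `^ (a2 + 2)) by eexists.
rewrite -eE -mE in lower; rewrite -XE in norm_le.
have m0 : 0 < m by rewrite mE mulr_gt0 ?powR_gt0 ?mulr_gt0.
have X0 : 0 <= X by rewrite XE !mulr_ge0 ?powR_ge0 ?(ltW K0).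
have Y0 : 0 <= Y by rewrite YE !mulr_ge0 ?powR_ge0 ?(ltW c10) ?(ltW c20).
have norm_ge0 : (0 <= integral_abs_powR (Vbi a1 a2) p (test_function n u1 l1 u2 l2))%E.
  by apply: integral_ge0 => z _; rewrite lee_fin powR_ge0.
have mu_le : (mu (carleson_box I1 I2) <= (m^-1 * (C * X `^ s))%:E)%E.
  rewrite EFinM -lee_pdivrMl ?invr_gt0// invrK.
  apply: le_trans lower (le_trans (HC _ fB) _).
  rewrite EFinM lee_wpmul2l ?lee_fin ?(ltW C0)//.
  rewrite -poweR_EFin; apply: gt0_ler_poweR => //; first exact: ltW.
  - by rewrite in_itv/= leey andbT.
  - by rewrite in_itv/= leey andbT lee_fin.
have VY : (Y%:E <= Vbi a1 a2 (carleson_box I1 I2))%E.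
  rewrite Vbi_carleson_box YE EFinM; apply: lee_pmul.
  - by rewrite lee_fin mulr_ge0 ?powR_ge0 ?(ltW c10).
  - by rewrite lee_fin mulr_ge0 ?powR_ge0 ?(ltW c20).
  - by rewrite c1E; exact: Valpha_carleson_square_ge.
  - by rewrite c2E; exact: Valpha_carleson_square_ge.
apply: le_trans mu_le _.
apply: (@le_trans _ _ (C' * Y `^ s)%:E); last first.
  rewrite EFinM lee_wpmul2l ?lee_fin ?(ltW C'0)//.
  rewrite -poweR_EFin; apply: gt0_ler_poweR => //; first exact: ltW.
  - by rewrite in_itv/= leey andbT lee_fin.
  - by rewrite in_itv/= leey andbT; apply: le_trans VY; rewrite lee_fin.
rewrite lee_fin le_eqVlt; apply/orP; left; apply/eqP.
have nps : n%:R * p * s = e by rewrite eE qE mulrA.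
have powE (a l : R) : 0 < l ->
    (l `^ (a + 2 - n%:R * p)) `^ s = (l `^ (a + 2)) `^ s * (l `^ e)^-1.
  move=> l0; rewrite gt0_powRD// powRM ?powR_ge0//; congr (_ * _).
  by rewrite -powRrM mulNr nps powRN.
have XsE : X `^ s = K `^ s * ((l1 `^ (a1 + 2)) `^ s / l1 `^ e *
                              ((l2 `^ (a2 + 2)) `^ s / l2 `^ e)).
  rewrite XE powRM ?(ltW K0) ?mulr_ge0 ?powR_ge0// powRM ?powR_ge0//.
  by rewrite (powE a1 l1 l10) (powE a2 l2 l20).
have YsE : Y `^ s = (c1 * c2) `^ s * ((l1 `^ (a1 + 2)) `^ s * (l2 `^ (a2 + 2)) `^ s).
  rewrite YE mulrACA (powRM _ (ltW (mulr_gt0 c10 c20)) (mulr_ge0 _ _)) ?powR_ge0//.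
  by rewrite (powRM _ (powR_ge0 l1 _) (powR_ge0 l2 _)).
have mE' : m^-1 = 3 `^ e * l1 `^ e * (3 `^ e * l2 `^ e).
  by rewrite mE !powRN !powRM ?(ltW l10) ?(ltW l20)// invfM !invrK.
have ne0 (x a : R) : 0 < x -> x `^ a != 0 by move=> x0; rewrite gt_eqF// powR_gt0.
rewrite mE' XsE YsE C'E.
move: (ne0 l1 e l10) (ne0 l2 e l20) (ne0 (c1 * c2) s (mulr_gt0 c10 c20)).
move: (l1 `^ e) (l2 `^ e) ((c1 * c2) `^ s) => y1 y2 y3 h1 h2 h3.
move: (3 `^ e) (K `^ s) ((l1 `^ (a1 + 2)) `^ s) ((l2 `^ (a2 + 2)) `^ s) => t k z1 z2.
by clear -h1 h2 h3; field; rewrite h1 h2 h3.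
Qed.

End necessity.

Theorem theorem5p2 (R : realType) (alpha1 alpha2 p q : R)
    (halpha1 : -1 < alpha1) (halpha2 : -1 < alpha2)
    (hp : 1 < p) (hpq : p <= q)
    (mu : {measure set (plane R * plane R) -> \bar R}) :
  carleson_measure (q / p) alpha1 alpha2 mu <->
  exists C : R, 0 < C /\
    forall f : R[i]^o * R[i]^o -> R[i]^o, bergman p alpha1 alpha2 f ->
      (integral_abs_powR mu q f <=
       C%:E * integral_abs_powR (Vbi alpha1 alpha2) p f `^ (q / p))%E.
Proof.
split; [exact: carleson_embedding | exact: carleson_necessary].
Qed.
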